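(* Let $\mu^\infty_0(1)$ be the largest point of the point process $\mathcal{M}_0$ (the process $\mathcal{M}_a$ with $a=0$), and let $\hat\mu^\infty_0(1)=\sum_{j=1}^\infty g_j$, where $(g_j)_{j\ge1}$ are independent random variables and $g_j$ is exponentially distributed with parameter $j^2/2$. Then $\mu^\infty_0(1)$ and $\hat\mu^\infty_0(1)$ have the same distribution.
   Context: The process $\mathcal{M}_a$, $a>-1$. Let $B$ be a standard Brownian motion. For $\delta\in\mathbb{R}$, $s\ge0$ let $Y^{\delta,s}(t)=\delta(t-s)+B(t)-B(s)$ and $$R^{(\delta,s)}(t)=Y^{\delta,s}(t)+\sup_{s\le u\le t}\max(0,-Y^{\delta,s}(u)),\quad t\ge s,$$ the Brownian motion with drift $\delta$ reflected at $0$, started from $0$ at time $s$. For $\mu>0$ let $c_\mu(t)=\mu+t/4$. Set $\xi^+_\mu(0)=0$ and, for $i\ge1$, $$\xi^-_\mu(i)=\inf\{t\ge\xi^+_\mu(i-1):R^{(-a/4,\,\xi^+_\mu(i-1))}(t)=c_\mu(t)\},\qquad \xi^+_\mu(i)=\inf\{t\ge\xi^-_\mu(i):R^{((a+1)/4,\,\xi^-_\mu(i))}(t)=c_\mu(t)\},$$ with $\inf\emptyset=\infty$ (and all later times equal to $\infty$). Let $\nu_\mu=\sum_{i\ge1}\delta_{\xi^+_\mu(i)}$ (sum over finite times only); the total mass $\nu_\mu(\mathbb{R}_+)$ is a.s. finite and non-increasing in $\mu$. The point process $\mathcal{M}_a$ on $(0,\infty)$ is defined by $\mathcal{M}_a([\mu,\infty))=\nu_\mu(\mathbb{R}_+)$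 for all $\mu>0$. Exponential of parameter $\theta$ means density $\theta e^{-\theta x}$ on $\mathbb{R}_+$. *)

(* Defs.v *)
From HB Require Import structures.
From mathcomp Require Import all_boot all_order all_algebra finmap.
From mathcomp Require Import all_classical all_reals all_analysis.

Set Implicit Arguments.
Unset Strict Implicit.
Unset Printing Implicit Defensive.
Import Order.TTheory GRing.Theory Num.Theory.
Import numFieldNormedType.Exports.
Local Open Scope classical_set_scope.
Local Open Scope ring_scope.

Definition mutually_independent (R : realType) (d : measure_display)
    (T : measurableType d) (P : probability T R) (I : choiceType)
    (X : I -> T -> R) : Prop :=
  forall (J : {fset I}) (A : I -> set R),
    (forall i, measurable (A i)) ->
    P (\bigcap_(i in [set` J]) (X i @^-1` A i))
      = (\prod_(i <- J) P (X i @^-1` A i))%E.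

(* Only the variables [B t] with [0 <= t] matter.  A finite nondecreasing list
   of times is an initial segment of an infinite one, so sequences of times
   suffice for the independence of increments.  The second parameter of
   [normal_prob] is the standard deviation. *)
Definition standard_brownian_motion (R : realType) (d : measure_display)
    (T : measurableType d) (P : probability T R) (B : R -> {RV P >-> R}) :
    Prop :=
  [/\ {ae P, forall w, B 0 w = 0},
      {ae P, forall w,
        {within `[0, +oo[, continuous (fun t : R => B t w : R)}},
      forall t : nat -> R, 0 <= t 0%N -> nondecreasing_seq t ->
        mutually_independent P (fun (i : nat) w => B (t i.+1) w - B (t i) w) &
      forall s t : R, 0 <= s -> s < t -> forall A : set R, measurable A ->
        P ((fun w => B t w - B s w) @^-1` A)
          = normal_prob 0 (Num.sqrt (t - s)) A].

Section path_functionals.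
Variables (R : realType) (b : R -> R).

Definition drifted (delta s t : R) : R := delta * (t - s) + b t - b s.

Definition reflected (delta s t : R) : R :=
  drifted delta s t
  + sup [set Num.max 0 (- drifted delta s u) | u in `[s, t]].

Definition line (mu t : R) : R := mu + t / 4.

(* [ereal_inf set0 = +oo]; a hitting time started at [+oo] is [+oo]. *)
Definition hitting_time (mu delta : R) (s : \bar R) : \bar R :=
  if s is s'%:E then
    ereal_inf [set t%:E | t in
      [set t : R | s' <= t /\ reflected delta s' t = line mu t]]
  else +oo%E.

(* [xi_plus a mu i] is xi^+_mu(i); the inner hitting time is xi^-_mu(i). *)
Fixpoint xi_plus (a mu : R) (i : nat) : \bar R :=
  if i is i'.+1 then
    hitting_time mu ((a + 1) / 4)
      (hitting_time mu (- a / 4) (xi_plus a mu i'))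
  else 0%E.

Definition nu (a mu : R) (A : set R) : \bar R :=
  (\sum_(1 <= i <oo | xi_plus a mu i \is a fin_num)
     \d_(fine (xi_plus a mu i)) A)%E.

End path_functionals.

Section point_measures.
Variables (R : realType) (m : {measure set R -> \bar R}).

Definition point_measure_on (E : set R) : Prop :=
  [/\ m (~` E) = 0%E,
      forall A : set R, measurable A ->
        m A = +oo%E \/ exists n : nat, m A = n%:R%:E &
      forall K : set R, compact K -> K `<=` E -> (m K < +oo)%E].

Definition largest_point (x : R) : Prop :=
  (0 < m [set x])%E /\ forall y : R, (0 < m [set y])%E -> y <= x.

End point_measures.

(* A kernel from the sample space is a random measure. *)
Definition process_M (R : realType) (d : measure_display)
    (T : measurableType d) (P : probability T R) (B : R -> {RV P >-> R})
    (a : R) (M : R.-ker T ~> R) : Prop :=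
  {ae P, forall w,
    point_measure_on (M w) `]0, +oo[%classic /\
    forall mu : R, 0 < mu ->
      M w `[mu, +oo[%classic = nu (fun t => B t w) a mu setT}.

(* Main.v *)
Require Import Defs.
From HB Require Import structures.
From mathcomp Require Import all_boot all_order all_algebra finmap.
From mathcomp Require Import all_classical all_reals all_analysis measurable_realfun.
From mathcomp Require Import ring lra.
Set Implicit Arguments.
Unset Strict Implicit.
Unset Printing Implicit Defensive.
Import Order.TTheory GRing.Theory Num.Theory.
Import numFieldNormedType.Exports.
Local Open Scope classical_set_scope.
Local Open Scope ring_scope.

(** The idea goes back to Doob's line-crossing formula.  For [a = 0] the process started
    at time [0] is [W - min W], and almost surely the second hitting time is
    finite as soon as the first one is: the reflected path with drift [1/4] is
    above [mu + t/4] once [W t - W u >= mu + u/4] for some [u <= t] after its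
    start, and such [u] exist at arbitrarily late times.
    Hence the largest point is at least [mu] iff [W - min W] hits [mu + t/4],
    that is, essentially, iff [W t - W u >= mu + t/4] for some [u <= t].
    For the reflected process [R], [cosh (s R(t)) exp (- s^2 t / 2)] is a
    martingale.  The alternating combination
      [\sum_(k >= 1) 2 (-1)^(k-1) exp (- k^2 c / 2) cosh (k r / 2)]
    equals [1] on the diagonal [r = c], because consecutive terms telescope, so
    the hitting probability is its value at [r = 0], [c = mu].  The martingale
    argument is carried out for the Lindley random walks obtained by sampling
    the increments of [B] on dyadic grids, where the error terms vanish with the
    mesh.  On the other side, the partial sums of the [g j] are
    hypoexponential, with tails given by partial fractions, and these tails
    converge to the same alternating series. *)

(** A walk on a grid differs from the reflected motion in two ways. Reflecting a jump below [0]
    loses [ch (s * overflow) - 1], so the stopped functional is only a supermartingale; and the line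
    is crossed with an overshoot. Overflow and overshoot are bounded by a single increment. If it is
    at most [delta], the loss is quadratic, hence at most a multiple of [delta] times the overflow,
    and the overflows have a bounded total mean (local time). Increments beyond [delta] cost of
    order [eps ^ 2] in mean, hence of order [eps] over the [tau / eps] steps up to the horizon
    [tau]. These bounds grow with the number [N] of terms and with the horizon, which dictates the
    order of limits: mesh, then horizon, then [N]. No infinite series is formed: the hitting
    probability and the tail of the exponential sum are both compared with the same truncation
    [doob N 0 x], with errors of order [expR (- (x / 2)) ^+ N]. Hitting times are real and grids are
    dyadic, so the two events only interlace at levels [x < y]; right-continuity of the tails closes
    the gap. *)

(** * Independence of a variable from the past of a sequence *)

Section independence.
Context (d : measure_display) (T : measurableType d) (R : realType).
Context (P : probability T R).
Implicit Types (X : nat -> {RV P >-> R}) (n : nat).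

Definition cylinders X n : set (set T) :=
  [set E | exists2 A : nat -> set R, (forall i, measurable (A i)) &
    E = \bigcap_(i in `I_n) (X i @^-1` A i)].

Lemma cylinders_setI X n : setI_closed (cylinders X n).
Proof.
move=> _ _ [A mA ->] [A' mA' ->]; exists (fun i => A i `&` A' i).
  by move=> i; exact: measurableI.
by rewrite -bigcapI.
Qed.

Lemma cylinders_measurable X n : cylinders X n `<=` measurable.
Proof.
move=> _ [A mA ->].
have [->|n0] := eqVneq n 0%N; first by rewrite II0 bigcap_set0.
apply: bigcap_measurable; first by exists 0%N => /=; rewrite lt0n.
by move=> i _; rewrite -[_ @^-1` _]setTI; exact: measurable_funPT.
Qed.

Lemma past_measurable X n E : <<s cylinders X n >> E -> measurable E.
Proof.
apply: smallest_sub; first exact: sigma_algebra_measurable.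
exact: cylinders_measurable.
Qed.

(** Two finite measures in [E], the two sides of the identity, agree on the pi-system of cylinders,
    where independence of a finite family applies; hence they agree on the sigma-algebra it
    generates. *)
Lemma mutually_independent_past X n E (B : set R) :
  mutually_independent P (fun i w => X i w) ->
  <<s cylinders X n >> E -> measurable B ->
  P (E `&` X n @^-1` B) = (P E * P (X n @^-1` B))%E.
Proof.
move=> indX pE mB.
have mXB : measurable (X n @^-1` B).
  by rewrite -[_ @^-1` _]setTI; exact: measurable_funPT.
have fB : P (X n @^-1` B) \is a fin_num by exact: fin_num_measure.
have fB0 : 0 <= fine (P (X n @^-1` B)) by exact: fine_ge0.
pose m1 := mrestr P mXB.
pose m2 := mscale (NngNum fB0) P.
suff : m1 E = m2 E.
  rewrite /m1 /m2 /mrestr /mscale /= => ->.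
  by rewrite muleC; congr (_ * _)%E; exact: fineK.
apply: (g_sigma_algebra_measure_unique (cylinders X n) _ (fun=> setT)) => //.
- exact: cylinders_measurable.
- by move=> _; exists (fun=> setT) => //; rewrite bigcapT.
- by rewrite bigcup_const.
- exact: cylinders_setI.
- move=> _ [A mA ->]; rewrite /m1 /m2 /mrestr /mscale /=.
  transitivity (P (X n @^-1` B) * P (\bigcap_(i in `I_n) (X i @^-1` A i)))%E;
    last by congr (_ * _)%E; exact/esym/fineK.
  pose J := [fset i in iota 0 n]%fset.
  have JE : [set` J] = `I_n.
    by apply/seteqP; split => i /=; rewrite !inE mem_iota add0n.
  pose A' i := if (i < n)%N then A i else B.
  have mA' i : measurable (A' i) by rewrite /A'; case: ifP.
  have EJ : \bigcap_(i in [set` J]) (X i @^-1` A' i) =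
            \bigcap_(i in `I_n) (X i @^-1` A i).
    by rewrite JE; apply: eq_bigcapr => i /= ni; rewrite /A' ni.
  have EJn : \bigcap_(i in [set` (n |` J)%fset]) (X i @^-1` A' i) =
            \bigcap_(i in `I_n) (X i @^-1` A i) `&` X n @^-1` B.
    rewrite -EJ; apply/seteqP; split => w /=.
      move=> h; split; last first.
        by have := h n; rewrite /A' ltnn /=; apply; rewrite /= !inE eqxx.
      by move=> i /= iJ; apply: h => /=; rewrite in_fset1U iJ orbT.
    move=> [h1 h2] i /=; rewrite in_fset1U => /orP[/eqP ->|iJ].
      by rewrite /A' ltnn.
    exact: h1.
  have nJ : n \notin J by rewrite !inE mem_iota add0n ltnn.
  have := indX (n |` J)%fset A' mA'; rewrite EJn => H.
  apply: etrans (etrans H _); first by [].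
  rewrite big_fsetU1//=; by rewrite -(indX J A')// EJ /A' ltnn.
- move=> _; apply: (@le_lt_trans _ _ (P (X n @^-1` B))); last first.
    by rewrite -ge0_fin_numE.
  by rewrite /= /mrestr setTI.
Qed.

End independence.

(** * Integrals under independence and against a density *)

Definition RV_of (d d' : measure_display) (T : measurableType d)
    (T' : measurableType d') (R : realType) (P : probability T R) (f : T -> T')
    (mf : measurable_fun setT f) : {RV P >-> T'} :=
  HB.pack_for {RV P >-> T'} f (isMeasurableFun.Build _ _ _ _ f mf).

Section independence_integral.
Context (d d1 d2 : measure_display) (T : measurableType d).
Context (T1 : measurableType d1) (T2 : measurableType d2) (R : realType).
Context (P : probability T R).

Definition indep2 (F : T -> T1) (V : T -> T2) := forall A B,
  measurable A -> measurable B ->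
  P (F @^-1` A `&` V @^-1` B) = (P (F @^-1` A) * P (V @^-1` B))%E.

(** The law of the pair and the product of the two laws agree on rectangles, hence everywhere; the
    rest is Tonelli. *)
Lemma indep2_integral (F : {RV P >-> T1}) (V : {RV P >-> T2})
    (f : T1 * T2 -> \bar R) : indep2 F V ->
  measurable_fun [set: T1 * T2] f -> (forall z, 0 <= f z)%E ->
  (\int[P]_w f (F w, V w) =
   \int[distribution P V]_y \int[distribution P F]_x f (x, y))%E.
Proof.
move=> FV mf f0.
have mFV : measurable_fun [set: T] (fun w => (F w, V w)).
  exact: measurable_fun_pair.
pose XY : {RV P >-> (T1 * T2)%type} := RV_of P mFV.
rewrite -fubini_tonelli// -fubini_tonelli1//.
transitivity (\int[distribution P XY]_z f z)%E.
  by rewrite ge0_integral_distribution.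
apply: eq_measure_integral => A mA _; apply/esym.
by apply: product_measure_unique => // B C mB mC; exact: FV.
Qed.

End independence_integral.

Section density.
Context (d : measure_display) (T : measurableType d) (R : realType).
Context (mu nu : {measure set T -> \bar R}) (p : T -> R).
Hypothesis p_ge0 : forall x, 0 <= p x.
Hypothesis measurable_p : measurable_fun setT p.
Hypothesis nuE : forall A, measurable A -> nu A = (\int[mu]_(x in A) (p x)%:E)%E.

Import HBNNSimple.

(** On simple functions this is [nuE] and linearity; monotone convergence along simple
    approximations does the rest. *)
Lemma ge0_integral_density (f : T -> \bar R) :
  measurable_fun setT f -> (forall x, 0 <= f x)%E ->
  (\int[nu]_x f x = \int[mu]_x (f x * (p x)%:E))%E.
Proof.
move=> mf f0.
have mpE : measurable_fun setT (EFin \o p) by exact/measurable_EFinP.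
have nnsfun_case (h : {nnsfun T >-> R}) :
    (\int[nu]_x (h x)%:E = \int[mu]_x ((h x)%:E * (p x)%:E))%E.
  rewrite integralT_nnsfun sintegralE.
  have mterm k : measurable_fun [set: T]
      (fun x => ((k * \1_(h @^-1` [set k]) x)%:E * (p x)%:E))%E.
    by apply: emeasurable_funM => //; exact/measurable_EFinP/measurable_funM.
  have term0 k x : (0 <= (k * \1_(h @^-1` [set k]) x)%:E * (p x)%:E)%E.
    by rewrite mule_ge0 ?lee_fin// -lee_fin EFinM nnfun_muleindic_ge0.
  under [RHS]eq_integral.
    move=> x _; rewrite fimfunE -fsumEFin// ge0_mule_fsuml; last first.
      by move=> r; rewrite EFinM nnfun_muleindic_ge0.
    over.
  rewrite ge0_integral_fsum//; apply: eq_fsbigr => k _.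
  have [k0|k0] := ltP k 0.
    rewrite preimage_nnfun0// measure0 mule0.
    by under eq_integral do rewrite indicE in_set0 mulr0 mul0e; rewrite integral0.
  rewrite nuE// integral_mkcond -ge0_integralZl//=.
  - apply: eq_integral => x _; rewrite patchE indicE.
    by case: ifP => _; rewrite ?mulr1// mulr0 mul0e mule0.
  - exact/(measurable_restrictT _ _).1/measurable_funTS.
  - by move=> x _; apply: erestrict_ge0 => y _; rewrite lee_fin.
pose f_ := nnsfun_approx measurableT mf.
transitivity (lim (\int[nu]_x (f_ n x)%:E @[n --> \oo])%E).
  rewrite -monotone_convergence//=.
  - by apply: eq_integral => x _; apply/esym/cvg_lim => //=; exact: cvg_nnsfun_approx.
  - by move=> n; exact/measurable_EFinP/measurable_funTS.
  - by move=> n x _; rewrite lee_fin.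
  - by move=> x _ a b ab; rewrite lee_fin; exact/lefP/nd_nnsfun_approx.
under eq_fun do rewrite nnsfun_case.
rewrite -monotone_convergence//=.
- apply: eq_integral => x _; apply/cvg_lim => //=.
  by apply: cvgeZr => //; exact: cvg_nnsfun_approx.
- by move=> n; apply: emeasurable_funM => //; exact/measurable_EFinP.
- by move=> n x _; rewrite mule_ge0// lee_fin.
- move=> x _ a b ab; rewrite lee_wpmul2r ?lee_fin//.
  exact/lefP/nd_nnsfun_approx.
Qed.

End density.

(** * Gaussian laws *)

Section normal_law.
Context (R : realType).
Implicit Types s sigma : R.

(** Completing the square turns [expR (s * x)] times the centred density into a constant times the
    density centred at [s * sigma ^+ 2]. *)
Lemma normal_mgf (nu : {measure set (measurableTypeR R) -> \bar R}) s sigma : 0 < sigma ->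
  (forall A, measurable A -> nu A = normal_prob 0 sigma A) ->
  (\int[nu]_x (expR (s * x))%:E = (expR (s ^+ 2 * sigma ^+ 2 / 2))%:E)%E.
Proof.
move=> sigma0 nuE.
rewrite (@ge0_integral_density _ _ R lebesgue_measure nu (normal_pdf 0 sigma))//.
- transitivity (\int[lebesgue_measure]_x
    ((expR (s ^+ 2 * sigma ^+ 2 / 2))%:E *
     (normal_pdf (s * sigma ^+ 2) sigma x)%:E))%E.
    apply: eq_integral => x _; rewrite -!EFinM; congr EFin.
    rewrite !normal_pdfE ?gt_eqF// /normal_fun mulrCA [RHS]mulrCA -!expRD.
    congr (_ * expR _); field; exact: lt0r_neq0.
  rewrite ge0_integralZl//.
  + by rewrite integral_normal_pdf mule1.
  + have h : measurable_fun [set: R] (EFin \o normal_pdf (s * sigma ^+ 2) sigma).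
      apply/measurable_EFinP. exact: measurable_normal_pdf.
    exact: h.
  + by move=> x _; rewrite lee_fin normal_pdf_ge0.
- exact: normal_pdf_ge0.
- exact: measurable_normal_pdf.
- by apply/measurable_EFinP; apply: measurableT_comp.
Qed.

(** By scaling, one [p] serves every [sigma]; this is what makes large increments recur along the
    times [sparse]. *)
Lemma normal_prob_tail : exists2 p : R, 0 < p &
  forall sigma, 0 < sigma -> (p%:E <= normal_prob 0 sigma `[sigma, +oo[)%E.
Proof.
(* The length [sigma] of the interval from [sigma] to [2 * sigma], times the density at its right
   end, where it is smallest. *)
exists (expR (- 2) / Num.sqrt (pi *+ 2)).
  by rewrite divr_gt0 ?expR_gt0// sqrtr_gt0 pmulrn_lgt0// pi_gt0.
move=> sigma sigma0.
apply: (@le_trans _ _ (normal_prob 0 sigma `[sigma, 2 * sigma]%classic));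
  last by apply: le_measure; rewrite ?inE//; exact: subset_itvl.
pose c : R := normal_pdf 0 sigma (2 * sigma).
pose D : set R := `[sigma, 2 * sigma]%classic.
have cle : (\int[lebesgue_measure]_(x in D) c%:E <=
    \int[lebesgue_measure]_(x in D) (normal_pdf 0 sigma x)%:E)%E.
  apply: ge0_le_integral => //.
  - exact: measurable_itv.
  - by move=> x _; rewrite lee_fin normal_pdf_ge0.
  - by apply/measurable_EFinP/measurable_funTS; exact: measurable_normal_pdf.
  - move=> x; rewrite /D /= in_itv/= => /andP[x1 x2]; rewrite lee_fin /c.
    rewrite !normal_pdfE ?gt_eqF// ler_wpM2l ?normal_peak_ge0//.
    rewrite /normal_fun ler_expR !subr0 !mulNr lerN2 ler_wpM2r//.
      by rewrite invr_ge0 mulrn_wge0// sqr_ge0.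
    by rewrite lerXn2r// ?nnegrE; lra.
apply: (le_trans _ cle); rewrite /D integral_cst//
    [X in (_ * X)%E](_ : _ = sigma%:E)%E; last first.
  rewrite /= lebesgue_measure_itv /= lte_fin.
  have -> : sigma < 2 * sigma by lra.
  by rewrite -EFinD; congr EFin; ring.
rewrite -EFinM lee_fin /c normal_pdfE ?gt_eqF// /normal_peak /normal_fun.
rewrite -[_ * pi *+ 2]mulrnAr sqrtrM ?sqr_ge0// sqrtr_sqr gtr0_norm//.
rewrite invfM.
have -> : - (2 * sigma - 0) ^+ 2 / (sigma ^+ 2 *+ 2) = - 2.
  by field; exact: lt0r_neq0.
have sp0 : 0 < Num.sqrt (pi *+ 2 : R) by rewrite sqrtr_gt0 pmulrn_lgt0// pi_gt0.
rewrite le_eqVlt; apply/orP; left; apply/eqP; field; apply/andP; split; exact: lt0r_neq0.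
Qed.

End normal_law.

(** * Real expectations *)

Section expectation.
Context (d : measure_display) (T : measurableType d) (R : realType).
Context (P : probability T R).
Implicit Types f g : T -> R.

Definition L1 f := P.-integrable [set: T] (EFin \o f).
Definition Ex f : R := \int[P]_w f w.

Lemma L1_measurable f : L1 f -> measurable_fun setT f.
Proof. by move=> /integrableP[mf _]; apply/measurable_EFinP. Qed.

Lemma L1_eq f g : f =1 g -> L1 f -> L1 g.
Proof. by move=> /funext ->. Qed.

Lemma L1D f g : L1 f -> L1 g -> L1 (fun w => f w + g w).
Proof.
by move=> lf lg; apply: eq_integrable (integrableD measurableT lf lg).
Qed.

Lemma L1B f g : L1 f -> L1 g -> L1 (fun w => f w - g w).
Proof.
by move=> lf lg; apply: eq_integrable (integrableB measurableT lf lg).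
Qed.

Lemma L1Z (c : R) f : L1 f -> L1 (fun w => c * f w).
Proof.
by move=> lf; apply: eq_integrable (integrableZl measurableT c lf).
Qed.

Lemma L1_cst (c : R) : L1 (fun=> c).
Proof. exact: finite_measure_integrable_cst. Qed.

Lemma L1_sum (I : Type) (s : seq I) (F : I -> T -> R) :
  (forall i, L1 (F i)) -> L1 (fun w => \sum_(i <- s) F i w).
Proof.
move=> lF; apply: (eq_integrable _ (fun w => \sum_(i <- s) (F i w)%:E)%E) => //.
  by move=> w _; rewrite /= sumEFin.
by apply: (@integrable_sum _ _ _ _ _ _ _ s xpredT (fun i w => (F i w)%:E)) => // i _; exact: lF.
Qed.

Lemma L1_le f g : measurable_fun setT f -> (forall w, `|f w| <= g w) ->
  L1 g -> L1 f.
Proof.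
move=> mf fg lg; apply: le_integrable lg => //; first exact/measurable_EFinP.
by move=> w _ /=; rewrite lee_fin (le_trans (fg w)) ?ler_norm.
Qed.

(** Passage from an extended integral, computed by Tonelli or from a law, to a real expectation. *)
Lemma L1_ge0 f (c : R) : measurable_fun setT f -> (forall w, 0 <= f w) ->
  (\int[P]_w (f w)%:E = c%:E)%E -> L1 f /\ Ex f = c.
Proof.
move=> mf f0 fc; split; last by rewrite /Ex /Rintegral fc.
apply/integrableP; split; first exact/measurable_EFinP.
under eq_integral do rewrite /= ger0_norm//.
by rewrite fc ltry.
Qed.

Lemma ExD f g : L1 f -> L1 g -> Ex (fun w => f w + g w) = Ex f + Ex g.
Proof. by move=> lf lg; exact: RintegralD. Qed.

Lemma ExB f g : L1 f -> L1 g -> Ex (fun w => f w - g w) = Ex f - Ex g.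
Proof. by move=> lf lg; exact: RintegralB. Qed.

Lemma ExZ (c : R) f : L1 f -> Ex (fun w => c * f w) = c * Ex f.
Proof. by move=> lf; exact: RintegralZl. Qed.

Lemma Ex_cst (c : R) : Ex (fun=> c) = c.
Proof.
have P1 : fine (P setT) = 1 by rewrite probability_setT.
by rewrite /Ex (Rintegral_cst P measurableT) P1 mulr1.
Qed.

Lemma Ex_sum (I : Type) (s : seq I) (F : I -> T -> R) :
  (forall i, L1 (F i)) ->
  Ex (fun w => \sum_(i <- s) F i w) = \sum_(i <- s) Ex (F i).
Proof.
move=> lF; elim: s => [|i s IH].
  by rewrite big_nil -[RHS](Ex_cst 0); apply: eq_Rintegral => w _; rewrite big_nil.
rewrite big_cons -IH -ExD//; last exact: L1_sum.
by apply: eq_Rintegral => w _; rewrite big_cons.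
Qed.

Lemma le_Ex f g : L1 f -> L1 g -> (forall w, f w <= g w) -> Ex f <= Ex g.
Proof. by move=> lf lg fg; apply: le_Rintegral. Qed.

Lemma Ex_ge0 f : (forall w, 0 <= f w) -> 0 <= Ex f.
Proof. by move=> f0; apply: Rintegral_ge0. Qed.

Lemma normr_Ex f : L1 f -> `|Ex f| <= Ex (fun w => `|f w|).
Proof. by move=> lf; apply: le_normr_Rintegral. Qed.

Lemma L1_ind (A : T -> bool) : measurable_fun setT A ->
  L1 (fun w => if A w then 1 else 0).
Proof.
move=> mA; apply: (@L1_le _ (fun=> 1)); last exact: L1_cst.
  exact: measurable_fun_ifT.
by move=> w; case: (A w); rewrite ?normr1// normr0.
Qed.

Lemma Ex_ind (A : T -> bool) : measurable_fun setT A ->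
  (Ex (fun w => if A w then 1 else 0))%:E = P [set w | A w].
Proof.
move=> mA; rewrite /Ex /Rintegral fineK; last first.
  exact: integrable_fin_num (L1_ind mA).
have mA' : measurable [set w | A w].
  by have := mA measurableT [set true] I; rewrite setTI.
rewrite -(setIT [set w | A w]) -integral_indic//.
apply: eq_integral => w _; rewrite indicE; congr EFin.
case: ifPn => Aw; first by rewrite mem_set.
by rewrite memNset//; exact/negP.
Qed.

End expectation.

(** * Estimates for the hyperbolic cosine *)

Section cosh.
Context (R : realType).
Implicit Types x y c : R.

Definition ch x := (expR x + expR (- x)) / 2.

Lemma ch0 : ch 0 = 1.
Proof. by rewrite /ch oppr0 expR0; field. Qed.

Lemma chN x : ch (- x) = ch x.
Proof. by rewrite /ch opprK addrC. Qed.

Lemma ch_norm x : ch `|x| = ch x.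
Proof. by case: (ger0P x) => // _; rewrite chN. Qed.

Lemma ch_ge1 x : 1 <= ch x.
Proof. by rewrite /ch; have := expR_ge1Dx x; have := expR_ge1Dx (- x); lra. Qed.

Lemma ch_gt1 x : x != 0 -> 1 < ch x.
Proof.
move=> x0; have := expR_gt1Dx x0.
have := @expR_gt1Dx _ (- x); rewrite oppr_eq0 => /(_ x0); rewrite /ch; lra.
Qed.

Lemma ch_gt0 x : 0 < ch x.
Proof. by rewrite (lt_le_trans _ (ch_ge1 x)). Qed.

Lemma expR_le_ch x : expR x <= 2 * ch x.
Proof. by rewrite /ch; have := expR_ge0 (- x); lra. Qed.

Lemma ch_le_expR x : ch x <= expR `|x|.
Proof.
rewrite -ch_norm /ch; have : expR (- `|x|) <= expR `|x|; last by lra.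
by rewrite ler_expR; have := normr_ge0 x; lra.
Qed.

Lemma chD x y : ch (x + y) =
  (expR x * expR y + expR (- x) * expR (- y)) / 2.
Proof. by rewrite /ch opprD !expRD. Qed.

Lemma ch_double x : ch (2 * x) = 2 * ch x ^+ 2 - 1.
Proof.
have e : expR x * expR (- x) = 1 by rewrite expRxMexpNx_1.
rewrite (_ : 2 * x = x + x) ?chD /ch; last by ring.
move: (expR x) (expR (- x)) e => a b e.
have -> : 2 * ((a + b) / 2) ^+ 2 = (a * a + b * b) / 2 + a * b by field.
by rewrite e addrK.
Qed.

Lemma ler_ch x y : 0 <= x -> x <= y -> ch x <= ch y.
Proof.
move=> x0 xy; rewrite /ch ler_wpM2r// -subr_ge0.
have e : expR x * expR (- x) = 1 by rewrite expRxMexpNx_1.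
have e' : expR y * expR (- y) = 1 by rewrite expRxMexpNx_1.
have xy' : expR x <= expR y by rewrite ler_expR.
have yx' : expR (- y) <= 1 by rewrite expR_le1; lra.
have xx' : expR (- x) <= 1 by rewrite expR_le1; lra.
have px := expR_gt0 (- x); have py := expR_gt0 (- y).
rewrite (_ : _ - _ = (expR y - expR x) * (1 - expR (- x) * expR (- y))).
  by rewrite mulr_ge0 ?subr_ge0// mulr_ile1// ltW.
move: (expR x) (expR y) (expR (- x)) (expR (- y)) e e' => a b a' b' e e'.
transitivity (b - (b * b') * a' - a + (a * a') * b'); last by ring.
by rewrite e e'; ring.
Qed.

(** The bound [1 + y <= expR y] at [x] and [- x] gives [ch x <= 1 / (1 - x ^+ 2)]. It makes the loss
    at a small reflection quadratic. *)
Lemma ch_small x : 0 <= x -> x <= 1 / 2 -> ch x - 1 <= 2 * x ^+ 2.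
Proof.
move=> x0 x1; rewrite /ch.
have e : expR x * expR (- x) = 1 by rewrite expRxMexpNx_1.
have a1 : expR x * (1 - x) <= 1.
  by rewrite -[leRHS]e ler_wpM2l ?expR_ge0// expR_ge1Dx.
have b1 : expR (- x) * (1 + x) <= 1.
  by rewrite -[leRHS]e [leRHS]mulrC ler_wpM2l ?expR_ge0// expR_ge1Dx.
have a0 := expR_ge0 x; have b0 := expR_ge0 (- x).
move: (expR x) (expR (- x)) a1 b1 a0 b0 {e} => a b a1 b1 a0 b0.
have x2 : x ^+ 2 <= 1 / 4 by rewrite expr2; nra.
have a2 : a * (1 - x ^+ 2) <= 1 + x by rewrite expr2; nra.
have b2 : b * (1 - x ^+ 2) <= 1 - x by rewrite expr2; nra.
have x2' : 0 <= x ^+ 2 by exact: sqr_ge0.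
move: (x ^+ 2) x2 a2 b2 x2' => z z1 a2 b2 z0.
have h : (a + b) * (1 - z) <= 2 by lra.
have h2 : (1 + 2 * z) * (1 - z) >= 1 by nra.
have h3 : (a + b) * (1 - z) <= 2 * (1 + 2 * z) * (1 - z) by lra.
have : a + b <= 2 * (1 + 2 * z) by rewrite -(ler_pM2r (_ : 0 < 1 - z))//; lra.
lra.
Qed.

(* Makes the tails of a small Gaussian increment of order [eps ^ 2] in
   expectation: the right-hand side is a combination of Laplace transforms. *)
Lemma expR_tail c delta : 0 < c -> 0 < delta -> exists2 K, 0 <= K &
  forall x, delta <= `|x| -> expR (c * `|x|) <= K * (ch (c * x) - 1) ^+ 2.
Proof.
move=> c0 d0; pose a := ch (c * delta) - 1.
have a0 : 0 < a by rewrite subr_gt0 ch_gt1// mulf_neq0 ?lt0r_neq0.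
(* With [b = ch (c * x) - 1 >= a], the exponential is at most [2 * b + 2], and
   [2 * b <= 2 / a * b ^+ 2], [2 <= 2 / a ^+ 2 * b ^+ 2]. *)
exists (2 / a + 2 / a ^+ 2) => [|x dx].
  by rewrite addr_ge0// divr_ge0// ?ltW// exprn_gt0.
have ax : a <= ch (c * x) - 1.
  rewrite lerD2r -(ch_norm (c * x)) normrM (gtr0_norm c0) ler_ch//.
    by rewrite mulr_ge0 ?ltW.
  by rewrite ler_pM2l.
apply: (le_trans (expR_le_ch _)); rewrite -[ch (c * `|x|)]ch_norm.
rewrite !normrM normr_id -normrM ch_norm.
move: (ch _) ax => z; set b := z - 1 => ax.
have -> : z = b + 1 by rewrite /b; ring.
have b0 : 0 < b by lra.
have h1 : 2 * b <= 2 / a * b ^+ 2.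
  by rewrite mulrAC ler_pdivlMr// expr2 mulrA ler_pM2l// mulr_gt0.
have h2 : 2 <= 2 / a ^+ 2 * b ^+ 2.
  rewrite mulrAC ler_pdivlMr ?exprn_gt0// ler_pM2l// lerXn2r ?nnegrE//; lra.
by rewrite mulrDl; lra.
Qed.

Lemma ch_incr x y : 0 <= x -> 0 <= y -> ch (x + y) - ch x <= expR x * (expR y - 1) / 2.
Proof.
move=> x0 y0; rewrite chD /ch.
have : expR (- x) * expR (- y) <= expR (- x).
  by rewrite -[leRHS]mulr1 ler_wpM2l ?expR_ge0// expR_le1; lra.
by rewrite mulrBr mulr1; lra.
Qed.

Lemma expR_sub1_le x : 0 <= x -> x <= 1 / 2 -> expR x - 1 <= 2 * x.
Proof.
move=> x0 x1; have e : expR x * expR (- x) = 1 by rewrite expRxMexpNx_1.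
have a1 : expR x * (1 - x) <= 1.
  by rewrite -[leRHS]e ler_wpM2l ?expR_ge0// expR_ge1Dx.
by move: (expR x) (expR_ge0 x) a1 => a a0 a1; nra.
Qed.

End cosh.

(** * Factorisation of expectations over the past *)

Section past.
Context (d : measure_display) (T : measurableType d) (R : realType).
Context (P : probability T R) (X : nat -> {RV P >-> R}).

(** The sigma-algebra is made a type so that measurability of a function on it expresses dependence
    on the first [n] variables only. *)
Definition past n := g_sigma_algebraType (cylinders X n).

Lemma past_measurable_fun n d2 (T2 : measurableType d2) (F : T -> T2) :
  measurable_fun (setT : set (past n)) F -> measurable_fun (setT : set T) F.
Proof.
move=> mF _ B mB; rewrite setTI.
have := mF measurableT B mB; rewrite setTI.
exact: past_measurable.
Qed.

Lemma measurable_past n i : (i < n)%N ->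
  measurable_fun (setT : set (past n)) (X i).
Proof.
move=> iltn _ B mB; rewrite setTI; apply: sub_sigma_algebra.
exists (fun j => if j == i then B else setT).
  by move=> j; case: ifP.
apply/seteqP; split => [w XB j /= _|w /(_ i iltn)] /=; last by rewrite eqxx.
by case: eqP => // ->.
Qed.

Hypothesis indX : mutually_independent P (fun i w => X i w).

Lemma indep2_past n d2 (T2 : measurableType d2) (F : T -> T2) :
  measurable_fun (setT : set (past n)) F -> indep2 P F (X n).
Proof.
move=> mF A B mA mB; apply: mutually_independent_past => //.
by have := mF measurableT A mA; rewrite setTI.
Qed.

Lemma Ex_past_mul n (F : T -> R) (h : R -> R) (c : R) :
  measurable_fun (setT : set (past n)) F -> (forall w, 0 <= F w) ->
  L1 P F -> measurable_fun setT h -> (forall x, 0 <= h x) ->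
  (\int[P]_w (h (X n w))%:E = c%:E)%E ->
  L1 P (fun w => F w * h (X n w)) /\
  Ex P (fun w => F w * h (X n w)) = Ex P F * c.
Proof.
move=> mF F0 lF mh h0 hc.
have mF' := past_measurable_fun mF.
have mhX : measurable_fun setT (h \o X n) by exact: measurableT_comp.
pose FR : {RV P >-> R} := RV_of P mF'.
(* The absolute value makes [f] nonnegative on the whole plane, as Tonelli requires; on the values
   of [F] it changes nothing. *)
pose f (z : R * R) : \bar R := (`|z.1| * h z.2)%:E.
have mf' : measurable_fun [set: R * R] f.
  apply/measurable_EFinP; apply: measurable_funM => //.
    exact: measurableT_comp.
  exact: measurableT_comp.
apply: L1_ge0 => [|w|]; [exact: measurable_funM|by rewrite mulr_ge0|].
have f0 z : (0 <= f z)%E by rewrite lee_fin mulr_ge0.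
have := @indep2_integral _ _ _ _ _ _ _ P FR (X n) f (indep2_past mF) mf' f0.
rewrite /f /= => E; transitivity (\int[P]_w (`|F w| * h (X n w))%:E)%E.
  by apply: eq_integral => w _; rewrite ger0_norm.
rewrite {}E.
have EF : (\int[P]_w (F w)%:E = (Ex P F)%:E)%E.
  by rewrite /Ex /Rintegral fineK//; exact: integrable_fin_num.
transitivity (\int[distribution P (X n)]_y ((Ex P F)%:E * (h y)%:E))%E.
  apply: eq_integral => y _.
  rewrite ge0_integral_distribution//=; last 2 first.
  - by apply/measurable_EFinP; apply: measurable_funM.
  - by move=> x; rewrite lee_fin mulr_ge0.
  rewrite -EF -ge0_integralZr//.
  - by apply: eq_integral => w _ /=; rewrite ger0_norm.
  - exact/measurable_EFinP.
  - by move=> w _; rewrite lee_fin.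
  - by rewrite lee_fin.
rewrite ge0_integralZl//.
- by rewrite ge0_integral_distribution//= ?hc ?EFinM//; exact/measurable_EFinP.
- exact/measurable_EFinP.
- by move=> y _; rewrite lee_fin.
- by rewrite lee_fin; exact: Ex_ge0.
Qed.

End past.

(** * The reflected walk and its first passage over the line *)

Section lindley.
Context (R : realType) (eps mu : R).
Implicit Types (x : nat -> R) (s : R) (u : nat -> R).

(* [lindley x] is the walk with increments [x] reflected at [0], [alive x i] says
   that it stayed below the line up to time [i], and [stopped x u] is [u] stopped
   at the first time the line is reached. *)
Fixpoint lindley x i : R :=
  if i is j.+1 then Num.max 0 (lindley x j + x j) else 0.

(** The push that reflection adds at step [j]: the discrete increment of local time at [0]. *)
Definition overflow x j : R := Num.max 0 (- (lindley x j + x j)).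

Definition level i : R := mu + i%:R * eps / 4.

Fixpoint alive x i : bool :=
  (lindley x i < level i) && (if i is j.+1 then alive x j else true).

Fixpoint stopped x u n : R :=
  if n is m.+1 then if alive x m then u n else stopped x u m else u 0%N.

Lemma lindley_ge0 x i : 0 <= lindley x i.
Proof. by case: i => //= i; rewrite le_max lexx. Qed.

Lemma overflow_ge0 x i : 0 <= overflow x i.
Proof. by rewrite le_max lexx. Qed.

Lemma lindleyS x i : lindley x i.+1 = lindley x i + x i + overflow x i.
Proof.
rewrite /= /overflow; set z := lindley x i + x i.
have [z0|z0] := leP 0 z.
  have nz : - z <= 0 by lra.
  by rewrite (max_l nz) addr0.
have nz : 0 <= - z by lra.
by rewrite (max_r nz) subrr.
Qed.

Lemma overflow_le x i : overflow x i <= `|x i|.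
Proof.
rewrite ge_max normr_ge0/=; have := lindley_ge0 x i.
have := ler_norm (- x i); rewrite normrN; lra.
Qed.

Lemma sum_overflow x n :
  \sum_(i < n) overflow x i = lindley x n - \sum_(i < n) x i.
Proof.
elim: n => [|n IH]; first by rewrite !big_ord0 subr0.
by rewrite !big_ord_recr IH lindleyS /=; ring.
Qed.

(** Either nothing is reflected, or the walk lands on [0] and, by parity, [ch] of the unreflected
    position is [ch (s * overflow x i)]. So the loss is exact. *)
Lemma ch_lindleyS x i s : ch (s * lindley x i.+1) =
  ch (s * (lindley x i + x i)) - (ch (s * overflow x i) - 1).
Proof.
rewrite lindleyS /overflow; set z := lindley x i + x i.
have [z0|z0] := leP 0 z.
  have nz : - z <= 0 by lra.
  by rewrite (max_l nz) addr0 mulr0 ch0 subrr subr0.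
have nz : 0 <= - z by lra.
by rewrite (max_r nz) subrr mulrN chN mulr0 ch0; ring.
Qed.

Lemma stopped_alive x u n : alive x n -> stopped x u n = u n.
Proof. by case: n => //= n /andP[_ ->]. Qed.

Lemma stoppedS x u n : stopped x u n.+1 =
  stopped x u n + (if alive x n then 1 else 0) * (u n.+1 - u n).
Proof.
rewrite [LHS]/=; case: ifPn => an; last by rewrite mul0r addr0.
by rewrite (stopped_alive _ an); ring.
Qed.

Lemma eq_stopped x u v n : u =1 v -> stopped x u n = stopped x v n.
Proof. by move=> uv; elim: n => //= n ->; rewrite !uv. Qed.

Lemma stopped_sum x (I : Type) (r : seq I) (c : I -> R) (u : I -> nat -> R) n :
  stopped x (fun i => \sum_(k <- r) c k * u k i) n =
  \sum_(k <- r) c k * stopped x (u k) n.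
Proof. by elim: n => //= n ->; case: ifP. Qed.

Hypotheses (eps_gt0 : 0 < eps) (mu_gt0 : 0 < mu).

Lemma level_homo i j : (i <= j)%N -> level i <= level j.
Proof.
by move=> ij; rewrite lerD2l ler_pM2r// ler_pM2r// ler_nat.
Qed.

Lemma level_ge_mu i : mu <= level i.
Proof. by rewrite lerDl mulr_ge0// mulr_ge0// ltW. Qed.

(** The walk starts at [0], below the line since [mu] is positive, so the stopping index has a
    predecessor at which the walk was still below. *)
Lemma stopped_hit x n : ~~ alive x n -> exists k,
  [/\ (k < n)%N, forall u, stopped x u n = u k.+1,
      lindley x k < level k & level k.+1 <= lindley x k.+1].
Proof.
elim: n => [|n IH]; first by rewrite /= andbT -leNgt /level mul0r mul0r addr0 leNgt mu_gt0.
rewrite /= negb_and; case: (boolP (alive x n)) => /= an; last first.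
  by move=> _; have [k [kn ku kl kh]] := IH an; exists k; split => //; exact: ltnW.
rewrite orbF -leNgt => nl; exists n; split => //.
by case: (n) an => [|m] /= /andP[].
Qed.

(** The line rises, so the overshoot is at most the last increment; landing at a positive level
    excludes a reflection in that step. *)
Lemma overshoot x k : lindley x k < level k -> level k.+1 <= lindley x k.+1 ->
  0 <= lindley x k.+1 - level k.+1 <= x k.
Proof.
move=> lk; have := level_homo (leqnSn k); have := level_ge_mu k.+1.
rewrite [lindley x k.+1]/=; have [z0|z0] := leP 0 (lindley x k + x k) => a b c.
  by apply/andP; split; lra.
by have := lt_le_trans mu_gt0 (le_trans a c); rewrite ltxx.
Qed.

End lindley.

(** * Exponential moments of the reflected walk *)

Section gaussian_walk.
Context (d : measure_display) (T : measurableType d) (R : realType).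
Context (P : probability T R) (X : nat -> {RV P >-> R}) (eps mu : R).
Hypothesis eps_gt0 : 0 < eps.
Hypothesis indX : mutually_independent P (fun i w => X i w).
Hypothesis mgfX : forall i s,
  (\int[P]_w (expR (s * X i w))%:E = (expR (s ^+ 2 * eps / 2))%:E)%E.

Let x (w : T) (j : nat) : R := X j w.
Let Z i w := lindley (x w) i.
Let alv i w := alive eps mu (x w) i.

Lemma lindley_past n i : (i <= n)%N ->
  measurable_fun (setT : set (past X n)) (Z i).
Proof.
elim: i => [_|i IH iltn]; first exact: measurable_cst.
apply: measurable_maxr; first exact: measurable_cst.
by apply: measurable_funD; [exact: IH (ltnW iltn)|exact: measurable_past].
Qed.

Lemma alive_past n i : (i <= n)%N ->
  measurable_fun (setT : set (past X n)) (alv i).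
Proof.
elim: i => [|i IH] iltn; apply: measurable_and.
- by apply: measurable_fun_ltr; [exact: lindley_past|exact: measurable_cst].
- exact: measurable_cst.
- by apply: measurable_fun_ltr; [exact: lindley_past|exact: measurable_cst].
- exact: IH (ltnW iltn).
Qed.

Lemma measurable_lindley i : measurable_fun setT (Z i).
Proof. exact: past_measurable_fun (@lindley_past i i _). Qed.

Lemma measurable_alive i : measurable_fun setT (alv i).
Proof. exact: past_measurable_fun (@alive_past i i _). Qed.

Lemma measurable_overflow i : measurable_fun setT (fun w => overflow (x w) i).
Proof.
apply: measurable_maxr => //; apply: measurableT_comp => //.
by apply: measurable_funD => //; exact: measurable_lindley.
Qed.

Lemma Ex_expR_mul n (F : T -> R) s :
  measurable_fun (setT : set (past X n)) F -> (forall w, 0 <= F w) -> L1 P F ->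
  L1 P (fun w => F w * expR (s * X n w)) /\
  Ex P (fun w => F w * expR (s * X n w)) = Ex P F * expR (s ^+ 2 * eps / 2).
Proof.
move=> mF F0 lF; apply: (@Ex_past_mul _ _ _ _ _ indX n F (fun y => expR (s * y))) => //.
by apply: measurableT_comp.
Qed.

(** [ch] is split into its two exponentials, to which independence applies separately; the variance
    factor is even in [s], so the halves recombine. *)
Lemma Ex_ch_mul n (G : T -> R) s :
  measurable_fun (setT : set (past X n)) G ->
  (forall w, 0 <= G w) ->
  (forall r, L1 P (fun w => G w * expR (r * Z n w))) ->
  L1 P (fun w => G w * ch (s * (Z n w + X n w))) /\
  Ex P (fun w => G w * ch (s * (Z n w + X n w))) =
  Ex P (fun w => G w * ch (s * Z n w)) * expR (s ^+ 2 * eps / 2).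
Proof.
move=> mG G0 lG.
pose F r w := G w * expR (r * Z n w).
have mF r : measurable_fun (setT : set (past X n)) (F r).
  apply: measurable_funM => //; apply: measurableT_comp => //.
  by apply: measurable_funM => //; exact: lindley_past.
have F0 r w : 0 <= F r w by rewrite mulr_ge0 ?expR_ge0.
have [l1 e1] := Ex_expR_mul s (mF s) (F0 s) (lG s).
have [l2 e2] := Ex_expR_mul (- s) (mF (- s)) (F0 (- s)) (lG (- s)).
have EZ : Ex P (fun w => G w * ch (s * Z n w)) =
    2^-1 * (Ex P (F s) + Ex P (F (- s))).
  rewrite -ExD ?lG// -ExZ; last by apply: L1D; exact: lG.
  by apply: eq_Rintegral => w _; rewrite /F /ch mulNr; ring.
have FE : (fun w => G w * ch (s * (Z n w + X n w))) =
    (fun w => 2^-1 * (F s w * expR (s * X n w) + F (- s) w * expR (- s * X n w))).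
  by apply/funext => w; rewrite /F mulrDr chD !mulNr; ring.
rewrite FE; split; first by apply: L1Z; exact: L1D.
rewrite ExZ; last exact: L1D.
by rewrite ExD// e1 e2 EZ sqrrN; ring.
Qed.

Lemma L1_expR_lindley n s : L1 P (fun w => expR (s * Z n w)).
Proof.
elim: n s => [|n IH] s; first by rewrite /Z /= mulr0; exact: L1_cst.
have m1 : measurable_fun (setT : set (past X n)) (fun w => expR (s * Z n w)).
  by apply: measurableT_comp => //; apply: measurable_funM => //; exact: lindley_past.
have [l1 _] := Ex_expR_mul s m1 (fun w => expR_ge0 _) (IH s).
apply: (@L1_le _ _ _ _ _ (fun w => 1 + expR (s * Z n w) * expR (s * X n w))).
- by apply: measurableT_comp => //; apply: measurable_funM => //; exact: measurable_lindley.
- move=> w; rewrite ger0_norm ?expR_ge0// -expRD -mulrDr /Z /=.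
  by have [_|_] := leP 0 (lindley (x w) n + x w n);
    rewrite ?mulr0 ?expR0 ?lerDl ?lerDr ?expR_ge0.
- by apply: L1D => //; exact: L1_cst.
Qed.

Lemma L1_ch_lindley n s : L1 P (fun w => ch (s * Z n w)).
Proof.
apply: (@L1_eq _ _ _ _ (fun w => 2^-1 * (expR (s * Z n w) + expR (- s * Z n w)))).
  by move=> w; rewrite /ch mulNr; ring.
by apply: L1Z; apply: L1D; exact: L1_expR_lindley.
Qed.

(** [ch_lindleyS] read backwards writes it as a combination of integrable terms. *)
Lemma L1_ch_overflow n s : L1 P (fun w => ch (s * overflow (x w) n)).
Proof.
have := L1_ch_lindley n s; have := L1_ch_lindley n.+1 s => l1 l2.
have [l3 _] := @Ex_ch_mul n (fun=> 1) s (measurable_cst _) (fun=> ler01)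
  (fun r => L1_eq (fun w => esym (mul1r _)) (L1_expR_lindley n r)).
apply: (@L1_eq _ _ _ _ (fun w => 1 * ch (s * (Z n w + X n w)) - ch (s * Z n.+1 w) + 1)).
  by move=> w; rewrite mul1r /Z ch_lindleyS /x; ring.
by apply: L1D; [exact: L1B|exact: L1_cst].
Qed.

(** Each increment contributes the factor [expR (s ^+ 2 * eps / 2)], and reflection only lowers
    [ch]. *)
Lemma Ex_ch_lindley n s :
  Ex P (fun w => ch (s * Z n w)) <= expR (s ^+ 2 * (n%:R * eps) / 2).
Proof.
elim: n => [|n IH].
  rewrite /Z /= !mul0r mulr0 mul0r expR0.
  by rewrite mulr0 ch0 Ex_cst.
have [l e] := @Ex_ch_mul n (fun=> 1) s (measurable_cst _) (fun=> ler01)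
  (fun r => L1_eq (fun w => esym (mul1r _)) (L1_expR_lindley n r)).
apply: (@le_trans _ _ (Ex P (fun w => 1 * ch (s * (Z n w + X n w))))).
  apply: le_Ex => //; first exact: L1_ch_lindley.
  move=> w; rewrite mul1r /Z ch_lindleyS /x; have := ch_ge1 (s * overflow (x w) n).
  by rewrite /x; lra.
rewrite e.
have -> : expR (s ^+ 2 * (n.+1%:R * eps) / 2) =
  expR (s ^+ 2 * (n%:R * eps) / 2) * expR (s ^+ 2 * eps / 2).
  by rewrite -expRD; congr expR; rewrite -natr1; ring.
rewrite ler_wpM2r ?expR_ge0//; apply: le_trans IH.
by rewrite le_eqVlt; apply/orP; left; apply/eqP; apply: eq_Rintegral => w _; rewrite mul1r.
Qed.

Lemma Ex_expR_sum n :
  let f w := expR (- \sum_(i < n) x w i) in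
  L1 P f /\ Ex P f = expR (n%:R * eps / 2).
Proof.
elim: n => [|n [l e]] /=.
  have fE : (fun w => expR (- \sum_(i < 0) x w i)) = (fun=> 1).
    by apply/funext => w; rewrite big_ord0 oppr0 expR0.
  by rewrite fE !mul0r expR0 Ex_cst; split => //; exact: L1_cst.
have fE : (fun w => expR (- \sum_(i < n.+1) x w i)) =
    (fun w => expR (- \sum_(i < n) x w i) * expR (-1 * X n w)).
  by apply/funext => w; rewrite big_ord_recr/= opprD expRD mulN1r.
have mF : measurable_fun (setT : set (past X n)) (fun w => expR (- \sum_(i < n) x w i)).
  apply: measurableT_comp => //; apply: measurableT_comp => //.
  apply: (@measurable_sum _ (past X n) _ setT _ _ (fun (i : 'I_n) w => x w i)) => i.
  exact: measurable_past.
have [l' e'] := Ex_expR_mul (-1) mF (fun w => expR_ge0 _) l.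
rewrite fE; split => //; rewrite e' e -expRD; congr expR.
by rewrite -natr1 sqrrN expr1n; ring.
Qed.

Lemma L1_overflow n : L1 P (fun w => overflow (x w) n).
Proof.
apply: (@L1_le _ _ _ _ _ (fun w => 2 * ch (1 * overflow (x w) n))).
- exact: measurable_overflow.
- move=> w; rewrite ger0_norm ?overflow_ge0// mul1r (le_trans _ (expR_le_ch _))//.
  by have := expR_ge1Dx (overflow (x w) n); lra.
- by apply: L1Z; exact: L1_ch_overflow.
Qed.

(* The reflection terms telescope: their sum is the local time [Z n - W n]. *)
Lemma Ex_sum_overflow n :
  \sum_(i < n) Ex P (fun w => overflow (x w) i) <= 3 * expR (n%:R * eps / 2).
Proof.
have [l e] := Ex_expR_sum n.
rewrite -Ex_sum; last by move=> i; exact: L1_overflow.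
have l2 : L1 P (fun w => 2 * ch (1 * Z n w)) by apply: L1Z; exact: L1_ch_lindley.
(* [y <= expR y] bounds the final position and minus the free walk by variables of controlled mean;
   the constant is [3 = 2 + 1]. *)
apply: (@le_trans _ _ (Ex P (fun w => 2 * ch (1 * Z n w) + expR (- \sum_(i < n) x w i)))).
  apply: le_Ex; first by apply: L1_sum => i; exact: L1_overflow.
    exact: L1D.
  move=> w; rewrite sum_overflow mul1r lerD//.
    by have := expR_le_ch (Z n w); have := expR_ge1Dx (Z n w); rewrite /Z; lra.
  by have := expR_ge1Dx (- \sum_(i < n) x w i); lra.
rewrite ExD// e ExZ; last exact: L1_ch_lindley.
have := Ex_ch_lindley n 1; rewrite expr1n mul1r; lra.
Qed.

End gaussian_walk.

(** * The truncated series on the line, just above it and below it *)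

Section doob_series.
Context (R : realType).
Implicit Types r c o : R.

(* Truncation of the series that solves the hitting problem; with
   [c = mu + t / 4] its [k]-th term is a multiple of [cosh (s r) exp (- s^2 t / 2)]
   for [s = k.+1 / 2]. *)
Definition doob N r c : R := \sum_(k < N)
  2 * (-1) ^+ k * expR (- (k.+1%:R ^+ 2 * c / 2)) * ch (k.+1%:R / 2 * r).

(** One boundary term of the telescoping sum survives, with sign [- (-1) ^+ N]. It does not increase
    with [c], so its value at [mu] bounds it along the whole line. *)
Lemma doob_diag N c : `|doob N c c - 1| = expR (- (N%:R * N.+1%:R * c / 2)).
Proof.
have -> : doob N c c - 1 = - (-1) ^+ N * expR (- (N%:R * N.+1%:R * c / 2)).
  elim: N => [|N IH].
    by rewrite /doob big_ord0 !mul0r oppr0 expR0 expr0; ring.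
  move: IH; rewrite /doob big_ord_recr/= => IH.
  rewrite addrAC IH.
  have e1 : expR (- (N.+1%:R ^+ 2 * c / 2)) * ch (N.+1%:R / 2 * c) =
      (expR (- (N%:R * N.+1%:R * c / 2)) + expR (- (N.+1%:R * N.+2%:R * c / 2))) / 2.
    rewrite /ch mulrA; congr (_ / 2).
    by rewrite mulrDr -!expRD; congr (expR _ + expR _); rewrite -!natr1; field.
  by rewrite -(mulrA (2 * (-1) ^+ N)) e1 exprS; field.
by rewrite normrM normrN normrX normrN1 expr1n mul1r ger0_norm ?expR_ge0.
Qed.

(** With [k >= 1] the number of the term, [expR (- (k ^ 2 * c / 2)) * expR (k * c / 2) <= 1]; so
    each of the [N] terms moves by at most [expR (N%:R / 2 * o) - 1]. *)
Lemma doob_overshoot N c o : 0 <= c -> 0 <= o ->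
  `|doob N (c + o) c - doob N c c| <= N%:R * (expR (N%:R / 2 * o) - 1).
Proof.
move=> c0 o0; rewrite /doob -sumrB.
apply: (le_trans (ler_norm_sum _ _ _)).
rewrite (_ : N%:R * _ = \sum_(k < N) (expR (N%:R / 2 * o) - 1)); last first.
  by rewrite sumr_const card_ord mulr_natl.
apply: ler_sum => k _; rewrite -mulrBr !normrM normrX normrN1 expr1n mulr1.
rewrite ger0_norm// (ger0_norm (expR_ge0 _)).
have k0 : 0 <= k.+1%:R / 2 :> R by rewrite divr_ge0.
have d0 : 0 <= ch (k.+1%:R / 2 * (c + o)) - ch (k.+1%:R / 2 * c).
  rewrite subr_ge0 ler_ch//; first by rewrite mulr_ge0.
  by rewrite ler_wpM2l// lerDl.
rewrite (ger0_norm d0).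
have := @ch_incr _ (k.+1%:R / 2 * c) (k.+1%:R / 2 * o) (mulr_ge0 k0 c0) (mulr_ge0 k0 o0).
rewrite -mulrDr => h.
apply: (@le_trans _ _ (2 * expR (- (k.+1%:R ^+ 2 * c / 2)) *
  (expR (k.+1%:R / 2 * c) * (expR (k.+1%:R / 2 * o) - 1) / 2))).
  by rewrite ler_wpM2l// mulr_ge0 ?expR_ge0.
rewrite (_ : _ * _ = expR (- (k.+1%:R ^+ 2 * c / 2)) * expR (k.+1%:R / 2 * c) *
  (expR (k.+1%:R / 2 * o) - 1)); last by field.
have e0 : 0 <= expR (k.+1%:R / 2 * o) - 1.
  by rewrite subr_ge0 -[leLHS]expR0 ler_expR mulr_ge0.
apply: (@le_trans _ _ (expR (k.+1%:R / 2 * o) - 1)).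
  rewrite ler_piMl// -expRD expR_le1.
  rewrite (_ : _ + _ = - (k.+1%:R * (k%:R * c) / 2)); last by rewrite -natr1; field.
  by rewrite oppr_le0 divr_ge0// mulr_ge0// mulr_ge0.
by rewrite lerD2r ler_expR ler_wpM2r// ler_wpM2r// ler_nat ltn_ord.
Qed.

(** The rate [4^-1] lies below [2^-1], the smallest one in the series. At time [t],
    [expR (- (c / 4))] is at most [expR (- (t / 16))], while the martingale of rate [4^-1] uses up
    only [expR (- (t / 32))]; the remaining [expR (- (t / 32))] makes surviving paths negligible.
    Rate [2^-1] would leave no such gain. *)
Lemma doob_below N r c : 0 <= r -> r <= c ->
  `|doob N r c| <= 4 * N%:R * (ch (4^-1 * r) * expR (- (c / 4))).
Proof.
move=> r0 rc; apply: (le_trans (ler_norm_sum _ _ _)).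
rewrite (_ : 4 * N%:R * _ = \sum_(k < N) (4 * (ch (4^-1 * r) * expR (- (c / 4)))));
  last by rewrite sumr_const card_ord mulrAC mulr_natr.
apply: ler_sum => k _; rewrite normrM (ger0_norm (ltW (ch_gt0 _))).
rewrite !normrM normrX normrN1 expr1n mulr1 ger0_norm// (ger0_norm (expR_ge0 _)).
have k0 : 0 <= k.+1%:R / 2 :> R by rewrite divr_ge0.
have k1 : 1 <= k.+1%:R :> R by rewrite ler1n.
have h1 : ch (k.+1%:R / 2 * r) <= expR (k.+1%:R / 2 * r).
  by rewrite (le_trans (ch_le_expR _))// ger0_norm// mulr_ge0.
have h2 : expR (- (k.+1%:R ^+ 2 * c / 2)) * expR (k.+1%:R / 2 * r) <=
    expR (4^-1 * r) * expR (- (c / 4)).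
  rewrite -!expRD ler_expR; move: (k.+1%:R) k1 => y y1.
  have c0 : 0 <= c by lra.
  have : y * (c - r) >= c - r by rewrite ler_peMl// subr_ge0.
  have : y * (y * c) >= y * c by rewrite ler_peMl// mulr_ge0//; lra.
  rewrite expr2; lra.
have h3 := expR_le_ch (4^-1 * r).
have e0 := expR_ge0 (- (k.+1%:R ^+ 2 * c / 2)); have e1 := expR_ge0 (- (c / 4)).
have h4 : expR (- (k.+1%:R ^+ 2 * c / 2)) * ch (k.+1%:R / 2 * r) <=
  expR (- (k.+1%:R ^+ 2 * c / 2)) * expR (k.+1%:R / 2 * r) by rewrite ler_wpM2l.
have h5 : expR (4^-1 * r) * expR (- (c / 4)) <= 2 * ch (4^-1 * r) * expR (- (c / 4)).
  by rewrite ler_wpM2r.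
lra.
Qed.

End doob_series.

(** * Optional stopping for the hyperbolic cosine *)

Section stopped_walk.
Context (d : measure_display) (T : measurableType d) (R : realType).
Context (P : probability T R) (X : nat -> {RV P >-> R}) (eps mu : R).
Hypothesis eps_gt0 : 0 < eps.
Hypothesis mu_gt0 : 0 < mu.
Hypothesis indX : mutually_independent P (fun i w => X i w).
Hypothesis mgfX : forall i s,
  (\int[P]_w (expR (s * X i w))%:E = (expR (s ^+ 2 * eps / 2))%:E)%E.

Let x (w : T) (j : nat) : R := X j w.
Let Z i w := lindley (x w) i.
Let alv i w := alive eps mu (x w) i.
Let ind i w : R := if alv i w then 1 else 0.

Lemma L1_ind_mul i f : L1 P f -> L1 P (fun w => ind i w * f w).
Proof.
move=> lf; apply: (@L1_le _ _ _ _ _ (fun w => `|f w|)).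
- apply: measurable_funM; last exact: L1_measurable lf.
  exact: measurable_fun_ifT (@measurable_alive _ _ _ _ X eps mu i) _ _.
- by move=> w; rewrite /ind; case: (alv i w); rewrite ?mul1r// mul0r normr0.
- exact: integrable_norm lf.
Qed.

(** [ch (s * r)] is an eigenfunction of the second derivative with zero slope at [0], whence a
    martingale for the reflected motion; for the walk this holds up to the loss. *)
Definition cosh_mart s (y : nat -> R) i : R :=
  ch (s * lindley y i) * expR (- (s ^+ 2 * (i%:R * eps) / 2)).

Let S s n w := stopped eps mu (x w) (cosh_mart s (x w)) n.

Let loss s n w := ind n w * (ch (s * overflow (x w) n) - 1).

Let L1_loss s n : L1 P (loss s n).
Proof.
apply: L1_ind_mul; apply: L1B; first exact: L1_ch_overflow mgfX _ _.
exact: L1_cst.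
Qed.

Lemma stopped_cosh_martS s n w : S s n.+1 w = S s n w +
  (expR (- (s ^+ 2 * (n.+1%:R * eps) / 2)) *
     (ind n w * ch (s * (Z n w + X n w)))
   - expR (- (s ^+ 2 * (n%:R * eps) / 2)) * (ind n w * ch (s * Z n w))
   - expR (- (s ^+ 2 * (n.+1%:R * eps) / 2)) * loss s n w).
Proof.
rewrite /S stoppedS {2}/cosh_mart ch_lindleyS /loss /ind /alv /Z /cosh_mart /x.
by case: ifP => _; ring.
Qed.

(** One free increment multiplies the mean of [ch] by [expR (s ^+ 2 * eps / 2)], which the time
    factor cancels; only the discounted loss remains. *)
Lemma Ex_stopped_cosh_martS s n : L1 P (S s n) -> L1 P (S s n.+1) /\
  Ex P (S s n.+1) = Ex P (S s n) -
  expR (- (s ^+ 2 * (n.+1%:R * eps) / 2)) * Ex P (loss s n).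
Proof.
move=> lS.
have mind : measurable_fun (setT : set (past X n)) (ind n).
  exact: measurable_fun_ifT (@alive_past _ _ _ _ X eps mu n n _) _ _.
have ind0 w : 0 <= ind n w by rewrite /ind; case: ifP.
have [l1 e1] := @Ex_ch_mul _ _ _ _ _ eps indX mgfX n (ind n) s mind ind0
  (fun r => L1_ind_mul n (@L1_expR_lindley _ _ _ _ _ _ indX mgfX n r)).
have l2 := L1_ind_mul n (@L1_ch_lindley _ _ _ _ _ _ indX mgfX n s).
have l3 := L1_loss s n.
pose c := expR (- (s ^+ 2 * (n%:R * eps) / 2)).
pose c' := expR (- (s ^+ 2 * (n.+1%:R * eps) / 2)).
have SE : S s n.+1 =1 (fun w => S s n w +
  (c' * (ind n w * ch (s * (Z n w + X n w))) - c * (ind n w * ch (s * Z n w))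
   - c' * loss s n w)) by move=> w; exact: stopped_cosh_martS.
rewrite (funext SE).
have l4 := L1Z c' l1; have l5 := L1Z c l2; have l6 := L1Z c' l3.
have l7 := L1B l4 l5; have l8 := L1B l7 l6.
split; first exact: L1D.
rewrite ExD// ExB// ExB// !ExZ// e1.
have -> : c = c' * expR (s ^+ 2 * eps / 2).
  by rewrite /c /c' -expRD; congr expR; rewrite -natr1; field.
by rewrite /c'; ring.
Qed.

Lemma L1_stopped_cosh_mart s n : L1 P (S s n).
Proof.
elim: n => [|n /Ex_stopped_cosh_martS[]//].
exact: (L1_cst P (ch (s * 0) * expR (- (s ^+ 2 * (0%:R * eps) / 2)))).
Qed.

(** A supermartingale started at [1]. The discount and the indicator are at most [1], so the deficit
    is at most the sum of the plain losses. *)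
Lemma Ex_stopped_cosh_mart s n : 1 - \sum_(i < n)
    Ex P (fun w => ch (s * overflow (x w) i) - 1) <= Ex P (S s n) <= 1.
Proof.
elim: n => [|n /andP[IH1 IH2]].
  rewrite big_ord0 subr0 (_ : Ex P _ = 1) ?lexx//.
  rewrite -[RHS](Ex_cst P); apply: eq_Rintegral => w _.
  by rewrite /S /= /cosh_mart /= mul0r !mulr0 ch0 mul0r oppr0 expR0 mulr1.
have [_ ->] := Ex_stopped_cosh_martS (L1_stopped_cosh_mart s n).
have loss0 w : 0 <= loss s n w.
  by rewrite mulr_ge0 ?subr_ge0 ?ch_ge1// /ind; case: ifP.
have El : Ex P (loss s n) <= Ex P (fun w => ch (s * overflow (x w) n) - 1).
  apply: le_Ex; first exact: L1_loss.
    by apply: L1B; [exact: L1_ch_overflow mgfX _ _|exact: L1_cst].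
  move=> w; rewrite /loss /ind; case: ifP => _; rewrite ?mul1r// mul0r.
  by rewrite subr_ge0 ch_ge1.
have El0 : 0 <= Ex P (loss s n) by exact: Ex_ge0.
have e0 := expR_ge0 (- (s ^+ 2 * (n.+1%:R * eps) / 2)).
have e1 : expR (- (s ^+ 2 * (n.+1%:R * eps) / 2)) <= 1.
  by rewrite expR_le1 oppr_le0 divr_ge0// mulr_ge0 ?sqr_ge0// mulr_ge0// ltW.
rewrite big_ord_recr/=; move: (expR _) e0 e1 => c c0 c1.
have : 0 <= c * Ex P (loss s n) <= Ex P (loss s n).
  by rewrite mulr_ge0//= ler_piMl.
move=> /andP[]; lra.
Qed.

(** Of fourth order at [0], hence of mean of order [eps ^ 2], yet exponentially large far out. *)
Definition tail c y : R := (ch (c * y) - 1) ^+ 2.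

Lemma Ex_tail c i : L1 P (fun w => tail c (x w i)) /\
  (c ^+ 2 * eps <= 1 ->
   Ex P (fun w => tail c (x w i)) <= 6 * (c ^+ 2 * eps) ^+ 2).
Proof.
have E r : L1 P (fun w => expR (r * x w i)) /\
    Ex P (fun w => expR (r * x w i)) = expR (r ^+ 2 * eps / 2).
  apply: L1_ge0 => [|w|]; [|exact: expR_ge0|exact: mgfX].
  by apply: measurableT_comp => //; exact: measurable_funM.
have C r : L1 P (fun w => ch (r * x w i)) /\
    Ex P (fun w => ch (r * x w i)) = expR (r ^+ 2 * eps / 2).
  have [l1 e1] := E r; have [l2 e2] := E (- r).
  have -> : (fun w => ch (r * x w i)) =
      (fun w => 2^-1 * (expR (r * x w i) + expR (- r * x w i))).
    by apply/funext => w; rewrite /ch mulNr mulrC.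
  split; first by apply: L1Z; exact: L1D.
  by rewrite ExZ ?ExD// ?e1 ?e2 ?sqrrN; [field|exact: L1D].
have [l1 e1] := C c; have [l2 e2] := C (2 * c).
have tE : (fun w => tail c (x w i)) =
    (fun w => 2^-1 * ch (2 * c * x w i) - 2 * ch (c * x w i) + 3 / 2).
  by apply/funext => w; rewrite /tail -mulrA ch_double; field.
have l3 := L1B (L1Z 2^-1 l2) (L1Z 2 l1); have l4 := L1_cst P (3 / 2).
rewrite tE; split; first exact: L1D.
move=> ce; rewrite ExD// ExB ?ExZ// ?e1 ?e2 ?Ex_cst; last 2 first.
- exact: L1Z.
- exact: L1Z.
have -> : expR ((2 * c) ^+ 2 * eps / 2) = expR (c ^+ 2 * eps / 2) ^+ 4.
  by rewrite -expRM_natl; congr expR; field.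
have y0 : 0 <= c ^+ 2 * eps by rewrite mulr_ge0 ?sqr_ge0 ?ltW.
move: (c ^+ 2 * eps) ce y0 => y ce y0.
have z1 : expR (y / 2) - 1 <= y by have := @expR_sub1_le _ (y / 2); lra.
have z0 : 1 <= expR (y / 2) by have := expR_ge1Dx (y / 2); lra.
move: (expR _) z0 z1 => z z0 z1.
(* The mean is [(z ^+ 4 - 4 * z + 3) / 2], with a double zero at [z = 1]; [z <= 2] bounds the
   cofactor by [6]. *)
rewrite (_ : _ + _ = (z - 1) ^+ 2 * (2^-1 * (z ^+ 2 + 2 * z + 3))); last by field.
rewrite mulrC; apply: ler_pM.
- by have := sqr_ge0 z; lra.
- exact: sqr_ge0.
- have : z ^+ 2 <= 2 * 2 by (rewrite expr2 ler_pM//; lra).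
  by lra.
- by rewrite lerXn2r ?nnegrE//; lra.
exact: L1_cst.
Qed.

End stopped_walk.

(** * The hitting probability of the walk, with explicit errors *)

Section hitting_probability.
Context (d : measure_display) (T : measurableType d) (R : realType).
Context (P : probability T R) (X : nat -> {RV P >-> R}) (eps mu : R).
Hypothesis eps_gt0 : 0 < eps.
Hypothesis mu_gt0 : 0 < mu.
Hypothesis indX : mutually_independent P (fun i w => X i w).
Hypothesis mgfX : forall i s,
  (\int[P]_w (expR (s * X i w))%:E = (expR (s ^+ 2 * eps / 2))%:E)%E.
Variables (c delta K : R).
Hypotheses (c_gt0 : 0 < c) (delta_gt0 : 0 < delta) (K_ge0 : 0 <= K).
Hypothesis cdelta : c * delta <= 1 / 2.
Hypothesis ceps : c ^+ 2 * eps <= 1.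
Hypothesis tailK : forall y, delta <= `|y| -> expR (c * `|y|) <= K * tail c y.

Let x (w : T) (j : nat) : R := X j w.
Let S s n w := stopped eps mu (x w) (cosh_mart eps s (x w)) n.

(** Up to [delta] the loss is quadratic and one factor is replaced by [delta]; what is left is
    linear in the overflow, whose sum has bounded mean. Beyond [delta] the increment itself is large
    and [tail] takes over. *)
Lemma ch_overflow_le w i : ch (c * overflow (x w) i) - 1 <=
  2 * c ^+ 2 * delta * overflow (x w) i + K * tail c (x w i).
Proof.
have y0 := overflow_ge0 (x w) i; have yx := overflow_le (x w) i.
move: (overflow _ _) y0 yx => y y0 yx.
have t0 : 0 <= tail c (x w i) by exact: sqr_ge0.
have Kt : 0 <= K * tail c (x w i) by exact: mulr_ge0.
have [yd|dy] := leP y delta.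
  have h1 : c * y <= 1 / 2 by apply: le_trans cdelta; rewrite ler_pM2l.
  have := ch_small (mulr_ge0 (ltW c_gt0) y0) h1.
  have : y ^+ 2 <= delta * y by rewrite expr2 ler_wpM2r.
  move=> /(ler_wpM2l (sqr_ge0 c)); rewrite exprMn; lra.
have h := tailK (le_trans (ltW dy) yx).
have cxy : ch (c * y) <= expR (c * `|x w i|).
  rewrite (le_trans (ch_le_expR _))// ler_expR (ger0_norm (mulr_ge0 (ltW c_gt0) y0)).
  by rewrite ler_pM2l.
have : 0 <= 2 * c ^+ 2 * delta * y.
  by rewrite mulr_ge0// mulr_ge0 ?ltW// mulr_gt0// exprn_gt0.
lra.
Qed.

(** Monotonicity of [ch] lets the single rate [c] serve every [s <= c]. The first [6] is [2] from
    the quadratic bound times [3] from the mean local time. *)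
Lemma Ex_stopped_error s n : 0 <= s -> s <= c ->
  `|Ex P (S s n) - 1| <= 6 * c ^+ 2 * delta * expR (n%:R * eps / 2)
     + n%:R * (K * (6 * (c ^+ 2 * eps) ^+ 2)).
Proof.
move=> s0 sc.
have /andP[h1 h2] := @Ex_stopped_cosh_mart _ _ _ _ _ eps mu eps_gt0 indX mgfX s n.
rewrite ler_norml; apply/andP; split; last first.
  apply: (@le_trans _ _ 0); first by rewrite subr_le0.
  rewrite addr_ge0//.
    by rewrite mulr_ge0 ?expR_ge0// mulr_ge0 ?ltW// mulr_gt0// exprn_gt0.
  by rewrite mulr_ge0// mulr_ge0// mulr_ge0// sqr_ge0.
suff : \sum_(i < n) Ex P (fun w => ch (s * overflow (x w) i) - 1) <=
    6 * c ^+ 2 * delta * expR (n%:R * eps / 2)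
     + n%:R * (K * (6 * (c ^+ 2 * eps) ^+ 2)).
  by move: h1; rewrite -/x; lra.
have Lo i := @L1_overflow _ _ _ _ _ _ indX mgfX i.
have Lt i := (@Ex_tail _ _ _ _ _ _ eps_gt0 mgfX c i).1.
apply: (@le_trans _ _ (\sum_(i < n)
   (2 * c ^+ 2 * delta * Ex P (fun w => overflow (x w) i) +
    K * (6 * (c ^+ 2 * eps) ^+ 2)))).
  apply: ler_sum => i _.
  apply: (@le_trans _ _ (2 * c ^+ 2 * delta * Ex P (fun w => overflow (x w) i) +
    K * Ex P (fun w => tail c (x w i)))); last first.
    by rewrite lerD2l ler_wpM2l//; exact: (@Ex_tail _ _ _ _ _ _ eps_gt0 mgfX c i).2.
  have := ExD (L1Z (2 * c ^+ 2 * delta) (Lo i)) (L1Z K (Lt i)).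
  rewrite (ExZ _ (Lo i)) (ExZ _ (Lt i)) => <-.
  apply: le_Ex.
  - by apply: L1B; [exact: (@L1_ch_overflow _ _ _ _ _ _ indX mgfX i s)|exact: L1_cst].
  - by apply: L1D; exact: L1Z.
  - move=> w; apply: le_trans (ch_overflow_le w i); rewrite lerD2r ler_ch//.
      by rewrite mulr_ge0// overflow_ge0.
    by rewrite ler_wpM2r// overflow_ge0.
rewrite big_split/= -mulr_sumr sumr_const card_ord -[X in _ + X <= _]mulr_natl.
rewrite lerD2r.
have := @Ex_sum_overflow _ _ _ _ _ _ indX mgfX n.
move=> /(@ler_wpM2l _ (2 * c ^+ 2 * delta) _ _ _) h.
apply: (le_trans (h _)); first by rewrite mulr_ge0 ?ltW// mulr_gt0// exprn_gt0.
by rewrite le_eqVlt; apply/orP; left; apply/eqP; ring.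
Qed.

Variable N : nat.
Hypothesis N_gt0 : (0 < N)%N.
Hypothesis cN : c = N%:R / 2.

Let h w i := doob N (lindley (x w) i) (level eps mu i).

(** The level is [mu + t / 4] at time [t = i%:R * eps], so its exponential splits into a constant
    and the discount at rate [k.+1%:R / 2]. *)
Lemma stopped_doobE w n : stopped eps mu (x w) (h w) n = \sum_(k < N)
  (2 * (-1) ^+ k * expR (- (k.+1%:R ^+ 2 * mu / 2))) * S (k.+1%:R / 2) n w.
Proof.
rewrite -stopped_sum; apply: eq_stopped => i; rewrite /h /doob.
apply: eq_bigr => k _; rewrite /cosh_mart /level.
have -> : expR (- (k.+1%:R ^+ 2 * (mu + i%:R * eps / 4) / 2)) =
    expR (- (k.+1%:R ^+ 2 * mu / 2)) *
    expR (- ((k.+1%:R / 2) ^+ 2 * (i%:R * eps) / 2)).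
  by rewrite -expRD; congr expR; field.
by ring.
Qed.

(** The last term covers paths still below the line, through [doob_below]. For a stopped path
    [doob_diag] compares with [1] on the line, and the overshoot is at most the last increment: an
    overshoot up to [delta] costs [2 * (c * delta)], a larger one the [tail] of that increment. The
    stopping step is random, hence the sum over all steps. *)
Lemma stopped_doob_error w n : `|stopped eps mu (x w) (h w) n -
    (if alive eps mu (x w) n then 0 else 1)| <=
  expR (- (N%:R * mu / 2)) + N%:R * (2 * (c * delta)) +
  N%:R * (K * \sum_(i < n) tail c (x w i)) +
  4 * N%:R * expR (- (n%:R * eps / 32)) * S 4^-1 n w.
Proof.
have N0 : 0 <= N%:R :> R by [].
have N1 : 1 <= N%:R :> R by rewrite ler1n.
have tail0 i : 0 <= tail c (x w i) by exact: sqr_ge0.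
have a0 := expR_ge0 (- (N%:R * mu / 2)).
have b0 : 0 <= N%:R * (2 * (c * delta)).
  by rewrite mulr_ge0// mulr_ge0// mulr_ge0// ltW.
have c0 : 0 <= N%:R * (K * \sum_(i < n) tail c (x w i)).
  by rewrite mulr_ge0// mulr_ge0// sumr_ge0.
have S0 : 0 <= S 4^-1 n w.
  rewrite /S; elim: n {c0} => [|n IH] /=.
    by rewrite mulr_ge0 ?expR_ge0// ltW// ch_gt0.
  by case: ifP => // _; rewrite mulr_ge0 ?expR_ge0// ltW// ch_gt0.
have d0 : 0 <= 4 * N%:R * expR (- (n%:R * eps / 32)) * S 4^-1 n w.
  by rewrite mulr_ge0// mulr_ge0 ?expR_ge0// mulr_ge0.
have [an|an] := boolP (alive eps mu (x w) n).
  rewrite subr0 stopped_alive//.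
  have ln : lindley (x w) n <= level eps mu n.
    by case: (n) an => [|m] /= /andP[/ltW].
  rewrite /h (le_trans (doob_below _ (lindley_ge0 _ _) ln))//.
  apply: (@le_trans _ _ (4 * N%:R * expR (- (n%:R * eps / 32)) * S 4^-1 n w)); last by lra.
  have e : expR (- (level eps mu n / 4)) <=
      expR (- (n%:R * eps / 32)) * expR (- (4^-1 ^+ 2 * (n%:R * eps) / 2)).
    rewrite -expRD ler_expR /level; move: (n%:R * eps) => t.
    rewrite (_ : 4^-1 ^+ 2 * t / 2 = t / 32); last by field.
    by have mu0 := mu_gt0; lra.
  rewrite /S stopped_alive// /cosh_mart.
  rewrite [leRHS](_ : _ = 4 * N%:R * (ch (4^-1 * lindley (x w) n) *
    (expR (- (n%:R * eps / 32)) * expR (- (4^-1 ^+ 2 * (n%:R * eps) / 2)))));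
    last by ring.
  rewrite ler_wpM2l//.
  by rewrite ler_wpM2l// ltW// ch_gt0.
have [k [kn -> lk lkS]] := stopped_hit mu_gt0 an.
have /andP[ov0 ox] := overshoot eps_gt0 mu_gt0 lk lkS.
set o := _ - _ in ov0 ox.
have lk0 : mu <= level eps mu k.+1 by exact: level_ge_mu.
have hE : h w k.+1 = doob N (level eps mu k.+1 + o) (level eps mu k.+1).
  by rewrite /h /o addrC subrK.
rewrite hE; set L := level _ _ _ in lk0 *.
have L0 : 0 <= L by apply: le_trans lk0; exact: ltW.
apply: (@le_trans _ _ (`|doob N (L + o) L - doob N L L| + `|doob N L L - 1|)).
  exact: ler_distD.
have e1 : `|doob N L L - 1| <= expR (- (N%:R * mu / 2)).
  rewrite doob_diag ler_expR lerN2 -!mulrA ler_wpM2l// mulrA ler_wpM2r//.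
  apply: (le_trans lk0); rewrite ler_peMl// ler1n//.
have e2 := doob_overshoot N L0 ov0.
rewrite -cN in e2.
suff : expR (c * o) - 1 <= 2 * (c * delta) + K * \sum_(i < n) tail c (x w i).
  move=> /(ler_wpM2l N0); rewrite mulrDr; lra.
have st0 : 0 <= K * \sum_(i < n) tail c (x w i) by rewrite mulr_ge0// sumr_ge0.
have [od|do_] := leP o delta.
  have co : c * o <= c * delta by rewrite ler_pM2l.
  have := @expR_sub1_le _ (c * o) (mulr_ge0 (ltW c_gt0) ov0) (le_trans co cdelta).
  lra.
have xo : delta <= `|x w k|.
  by rewrite (le_trans (ltW do_))// (le_trans ox)// ler_norm.
have := tailK xo.
have : expR (c * o) <= expR (c * `|x w k|).
  by rewrite ler_expR ler_pM2l// (le_trans ox)// ler_norm.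
have : K * tail c (x w k) <= K * \sum_(i < n) tail c (x w i).
  rewrite ler_wpM2l// (bigD1 (Ordinal kn))//= lerDl sumr_ge0//.
have : 0 <= c * delta by rewrite mulr_ge0// ltW.
lra.
Qed.

(** Each stopped term has mean near [1] and a coefficient of modulus at most [2], so the stopped
    series has mean near its value at [r = 0], where every [ch] is [1]. *)
Lemma hitting_error n :
  `|Ex P (fun w => if alive eps mu (x w) n then 0 else 1) - doob N 0 mu| <=
  expR (- (N%:R * mu / 2)) + 4 * N%:R * expR (- (n%:R * eps / 32)) +
  (N%:R * (2 * (c * delta)) +
   N%:R * (n%:R * (K * (6 * (c ^+ 2 * eps) ^+ 2))) +
   N%:R * (2 * (6 * c ^+ 2 * delta * expR (n%:R * eps / 2)
     + n%:R * (K * (6 * (c ^+ 2 * eps) ^+ 2))))).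
Proof.
pose E := 6 * c ^+ 2 * delta * expR (n%:R * eps / 2)
     + n%:R * (K * (6 * (c ^+ 2 * eps) ^+ 2)).
pose H w := stopped eps mu (x w) (h w) n.
have LS s := @L1_stopped_cosh_mart _ _ _ _ _ _ mu indX mgfX s n.
have Lt i := (@Ex_tail _ _ _ _ _ _ eps_gt0 mgfX c i).
have HE : H = (fun w => \sum_(k < N)
  (2 * (-1) ^+ k * expR (- (k.+1%:R ^+ 2 * mu / 2))) * S (k.+1%:R / 2) n w).
  by apply/funext => w; exact: stopped_doobE.
have LH : L1 P H.
  by rewrite HE; apply: L1_sum => k; apply: L1Z; exact: LS.
pose a w : R := if alive eps mu (x w) n then 0 else 1.
have La : L1 P a.
  apply: (@L1_eq _ _ _ _ (fun w => 1 - (if alive eps mu (x w) n then 1 else 0))).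
    by move=> w; rewrite /a; case: ifP => _; rewrite ?subrr ?subr0.
  apply: L1B; first exact: L1_cst.
  by apply: L1_ind; exact: (@measurable_alive _ _ _ _ X eps mu n).
have step1 : `|Ex P H - doob N 0 mu| <= N%:R * (2 * E).
  rewrite HE Ex_sum; last by move=> k; apply: L1Z; exact: LS.
  rewrite /doob -sumrB (le_trans (ler_norm_sum _ _ _))//.
  rewrite (_ : N%:R * (2 * E) = \sum_(k < N) (2 * E)); last first.
    by rewrite sumr_const card_ord mulr_natl.
  apply: ler_sum => k _; rewrite mulr0 ch0 ExZ; last exact: LS.
  rewrite -mulrBr normrM; apply: ler_pM => //.
    rewrite !normrM normrX normrN1 expr1n mulr1 ger0_norm//.
    rewrite (ger0_norm (expR_ge0 _)) -[leRHS]mulr1 ler_pM2l// expR_le1.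
    by rewrite oppr_le0 divr_ge0// mulr_ge0 ?sqr_ge0// ltW.
  apply: Ex_stopped_error; first by rewrite divr_ge0.
  by rewrite cN ler_wpM2r// ler_nat.
have step2 : `|Ex P H - Ex P a| <= expR (- (N%:R * mu / 2)) + N%:R * (2 * (c * delta)) +
  N%:R * (n%:R * (K * (6 * (c ^+ 2 * eps) ^+ 2))) +
  4 * N%:R * expR (- (n%:R * eps / 32)).
  rewrite -ExB// (le_trans (normr_Ex (L1B LH La)))//.
  have L2 : L1 P (fun w => N%:R * (K * \sum_(i < n) tail c (x w i))).
    by do 2 apply: L1Z; apply: L1_sum => i; exact: (Lt i).1.
  have L3 : L1 P (fun w => 4 * N%:R * expR (- (n%:R * eps / 32)) * S 4^-1 n w).
    by apply: L1Z; exact: LS.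
  have L4 := L1_cst P (expR (- (N%:R * mu / 2)) + N%:R * (2 * (c * delta))).
  have := le_Ex (integrable_norm (L1B LH La)) (L1D (L1D L4 L2) L3)
    (fun w => stopped_doob_error w n).
  move/le_trans; apply.
  rewrite ExD//; last exact: L1D.
  rewrite ExD// Ex_cst lerD//.
    rewrite lerD2l ExZ; last by apply: L1Z; apply: L1_sum => i; exact: (Lt i).1.
    rewrite ExZ; last by apply: L1_sum => i; exact: (Lt i).1.
    rewrite Ex_sum; last by move=> i; exact: (Lt i).1.
    rewrite ler_wpM2l// [leRHS]mulrCA ler_wpM2l//.
    rewrite [leRHS](_ : _ = \sum_(i < n) (6 * (c ^+ 2 * eps) ^+ 2)); last first.
      by rewrite sumr_const card_ord -[RHS]mulr_natl.
    by apply: ler_sum => i _; exact: (Lt i).2.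
  rewrite ExZ; last exact: LS.
  rewrite -[leRHS]mulr1 ler_wpM2l//.
  by have /andP[] := @Ex_stopped_cosh_mart _ _ _ _ _ eps mu eps_gt0 indX mgfX 4^-1 n.
apply: (le_trans (ler_distD (Ex P H) _ _)); rewrite distrC.
apply: (le_trans (lerD step2 step1)); rewrite /E.
by rewrite le_eqVlt; apply/orP; left; apply/eqP; ring.
Qed.

End hitting_probability.

(** The order of choices matters: [c] from [N], then [delta] against the terms linear in it
    (coefficient [D]), then [K], which depends on [delta], and last [eps0] against the terms
    carrying [K] (coefficient [C]). As [n%:R * eps = tau], [n] errors of order [eps ^ 2] add up to
    order [eps]. *)
Lemma hitting_limit (d : measure_display) (T : measurableType d) (R : realType)
    (P : probability T R) (mu : R) (N : nat) (tau e : R) :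
  0 < mu -> (0 < N)%N -> 0 <= tau -> 0 < e -> exists2 eps0 : R, 0 < eps0 &
  forall (X : nat -> {RV P >-> R}) eps n, 0 < eps -> eps < eps0 ->
    n%:R * eps = tau ->
    mutually_independent P (fun i w => X i w) ->
    (forall i s, (\int[P]_w (expR (s * X i w))%:E = (expR (s ^+ 2 * eps / 2))%:E)%E) ->
    `|Ex P (fun w => if alive eps mu (fun j => X j w) n then 0 else 1)
        - doob N 0 mu| <=
    expR (- (N%:R * mu / 2)) + 4 * N%:R * expR (- (tau / 32)) + e.
Proof.
move=> mu0 N0 tau0 e0; pose c : R := N%:R / 2.
have N1 : 1 <= N%:R :> R by rewrite ler1n.
have c0 : 0 < c by rewrite divr_gt0// ltr0n.
pose D : R := N%:R * (2 * c) + N%:R * (12 * c ^+ 2 * expR (tau / 2)).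
have D0 : 0 < D.
  have n0 : 0 < N%:R :> R by rewrite ltr0n.
  by rewrite addr_gt0// mulr_gt0// mulr_gt0// ?expR_gt0// mulr_gt0// exprn_gt0.
pose delta : R := Num.min (1 / (2 * c)) (e / (2 * D)).
have delta0 : 0 < delta by rewrite lt_min !divr_gt0// mulr_gt0.
have cdelta : c * delta <= 1 / 2.
  have : delta <= 1 / (2 * c) by rewrite ge_min lexx.
  move=> /(ler_wpM2l (ltW c0)) /le_trans; apply.
  by rewrite le_eqVlt; apply/orP; left; apply/eqP; field; exact: lt0r_neq0.
have Ddelta : D * delta <= e / 2.
  rewrite mulrC -ler_pdivlMr//; apply: (@le_trans _ _ (e / (2 * D))).
    by rewrite ge_min lexx orbT.
  by rewrite invfM mulrA.
have [K K0 tailK] := expR_tail c0 delta0.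
pose C : R := N%:R * (tau * (K * (6 * c ^+ 4))) +
              N%:R * (2 * (tau * (K * (6 * c ^+ 4)))).
have C0 : 0 <= C.
  have k0 : 0 <= tau * (K * (6 * c ^+ 4)).
    by rewrite mulr_ge0// mulr_ge0// mulr_ge0// exprn_ge0// ltW.
  by rewrite addr_ge0// mulr_ge0// mulr_ge0.
pose eps0 : R := Num.min (1 / c ^+ 2) (e / (2 * (C + 1))).
exists eps0 => [|X eps n eps_gt0 epslt neps indX mgfX].
  by rewrite lt_min !divr_gt0// ?exprn_gt0// mulr_gt0// ltr_wpDl.
have ceps : c ^+ 2 * eps <= 1.
  rewrite mulrC -ler_pdivlMr ?exprn_gt0//.
  by rewrite (le_trans (ltW epslt))// ge_min lexx.
have Ceps : C * eps <= e / 2.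
  apply: (@le_trans _ _ ((C + 1) * eps)); first by rewrite ler_pM2r// lerDl.
  rewrite mulrC -ler_pdivlMr ?ltr_wpDl//; apply: (@le_trans _ _ (e / (2 * (C + 1)))).
    by rewrite (le_trans (ltW epslt))// ge_min lexx orbT.
  by rewrite invfM mulrA.
have := @hitting_error _ _ _ P X eps mu eps_gt0 mu0 indX mgfX c delta K c0 delta0
  K0 cdelta ceps tailK N N0 erefl n.
move/le_trans; apply; rewrite neps lerD2l.
apply: (@le_trans _ _ (D * delta + C * eps)); last by lra.
rewrite le_eqVlt; apply/orP; left; apply/eqP.
have -> : n%:R * (K * (6 * (c ^+ 2 * eps) ^+ 2)) = tau * (K * (6 * c ^+ 4)) * eps.
  by rewrite -neps; ring.
by rewrite /D /C; ring.
Qed.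

(** * From grid walks to crossings by a sampled path *)

Section dyadic_crossing.
Context (R : realType).
Implicit Types (y : nat -> R) (b : R -> R).

(** A step either restarts at [0], which adds [j = i.+1], or shifts the earlier differences by the
    new increment; unrolled, the recursion is a maximum of differences. *)
Lemma le_lindley y i c : c <= lindley (fun k => y k.+1 - y k) i <->
  exists2 j, (j <= i)%N & c <= y i - y j.
Proof.
elim: i c => [|i IH] c /=.
  split=> [c0|[j]]; first by exists 0%N => //; rewrite subrr.
  by rewrite leqn0 => /eqP ->; rewrite subrr.
rewrite le_max; split=> [/orP[c0|cl]|[j]].
- by exists i.+1 => //; rewrite subrr.
- have /IH[j ji cy] : c - (y i.+1 - y i) <= lindley (fun k => y k.+1 - y k) i by lra.
  by exists j; [exact: leqW|lra].
- rewrite leq_eqVlt => /predU1P[->|ji cy]; first by rewrite subrr => ->.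
  apply/orP; right.
  have : c - (y i.+1 - y i) <= lindley (fun k => y k.+1 - y k) i.
    by apply/IH; exists j => //; lra.
  lra.
Qed.

Lemma not_aliveP eps mu y n : ~~ alive eps mu (fun k => y k.+1 - y k) n <->
  exists i j, [/\ (j <= i)%N, (i <= n)%N & level eps mu i <= y i - y j].
Proof.
elim: n => [|n IH] /=.
  rewrite andbT -leNgt; split=> [h|[i [j []]]].
    by exists 0%N, 0%N; split => //; rewrite subrr.
  move=> ji; rewrite leqn0 => /eqP i0; move: ji; rewrite i0 leqn0 => /eqP ->.
  by rewrite subrr.
rewrite negb_and -leNgt; split=> [/orP[|/IH[i [j [ji in_ h]]]]|[i [j [ji]]]].
- by move=> /(le_lindley y n.+1)[j jn h]; exists n.+1, j.
- by exists i, j; split => //; exact: leqW.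
- rewrite leq_eqVlt => /predU1P[ie|in_] h; apply/orP.
    by left; apply/(le_lindley y n.+1); exists j; rewrite -?ie.
  by right; apply/IH; exists i, j.
Qed.

Definition dyadic (m k : nat) : R := k%:R / 2 ^+ m.

Definition dyadic_cross b mu m n := exists i j, [/\ (j <= i)%N, (i <= n)%N &
  mu + dyadic m i / 4 <= b (dyadic m i) - b (dyadic m j)].

Lemma dyadicS m k : dyadic m k = dyadic m.+1 (2 * k).
Proof.
by rewrite /dyadic natrM exprS invfM mulrACA divff// mul1r.
Qed.

Lemma dyadic_crossS b mu m n n' : (2 * n <= n')%N ->
  dyadic_cross b mu m n -> dyadic_cross b mu m.+1 n'.
Proof.
move=> nn [i [j [ji in_ h]]]; exists (2 * i)%N, (2 * j)%N; rewrite -!dyadicS.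
by split=> //; [rewrite leq_mul2l|rewrite (leq_trans _ nn)// leq_mul2l].
Qed.

End dyadic_crossing.

(** Continuity from below; the slack [e] lets bounds valid only for late [n] pass to the union. It
    serves for the mesh, the horizon and the number of summands. *)
Lemma probability_limit (d : measure_display) (T : measurableType d)
    (R : realType) (P : probability T R) (F : nat -> set T) (a b : R) :
  (forall n, measurable (F n)) -> nondecreasing_seq F ->
  (forall e, 0 < e -> exists n0, forall n, (n0 <= n)%N ->
     `|fine (P (F n)) - a| <= b + e) ->
  `|fine (P (\bigcup_n F n)) - a| <= b.
Proof.
move=> mF ndF h.
have cF : fine \o (P \o F) @ \oo --> fine (P (\bigcup_n F n)).
  apply: fine_cvg; rewrite fineK; last first.
    by apply: fin_num_measure; exact: bigcupT_measurable.
  by apply: nondecreasing_cvg_mu => //; exact: bigcupT_measurable.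
apply/ler_addgt0Pr => e e0.
have e2 : 0 < e / 2 by rewrite divr_gt0.
have [n0 hn0] := h _ e2.
have /cvgrPdist_le/(_ _ e2)[n1 _ hn1] := cF.
pose n := maxn n0 n1.
have := hn0 n (leq_maxl _ _); have := hn1 n (leq_maxr _ _) => /= h1 h2.
by rewrite (le_trans (ler_distD (fine (P (F n))) _ _))//; lra.
Qed.

Lemma dyadic_ge0 (R : realType) m k : 0 <= dyadic R m k.
Proof. by rewrite divr_ge0// exprn_ge0. Qed.

Lemma dyadic_homo (R : realType) m : {homo dyadic R m : i j / (i <= j)%N >-> i <= j}.
Proof. by move=> i j ij; rewrite ler_pM2r ?invr_gt0 ?exprn_gt0// ler_nat. Qed.

Lemma invX2_small (R : realType) (e : R) : 0 < e ->
  exists n0, forall m, (n0 <= m)%N -> (2 ^+ m)^-1 < e.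
Proof.
move=> e0; exists (Num.bound e^-1) => m nm.
rewrite invf_plt ?posrE ?exprn_gt0//.
have : e^-1 < (Num.bound e^-1)%:R by apply: archi_boundP; rewrite invr_ge0 ltW.
move/lt_le_trans; apply; rewrite -natrX ler_nat.
by rewrite (leq_trans nm)// ltnW// ltn_expl.
Qed.

Lemma expRN_small (R : realType) (a e : R) : 0 < e ->
  exists n0, forall n, (n0 <= n)%N -> a * expR (- (n%:R / 32)) <= e.
Proof.
move=> e0; exists (Num.bound (32 * `|a| / e)) => n nm.
have h : 32 * `|a| / e < n%:R.
  apply: (@lt_le_trans _ _ (Num.bound (32 * `|a| / e))%:R); last by rewrite ler_nat.
  by apply: archi_boundP; rewrite divr_ge0 ?mulr_ge0// ltW.
rewrite ltr_pdivrMr// in h.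
apply: (@le_trans _ _ (`|a| * expR (- (n%:R / 32)))).
  by rewrite ler_wpM2r ?expR_ge0// ler_norm.
have n0 : 0 <= n%:R :> R by [].
have ee : expR (n%:R / 32 : R) * expR (- (n%:R / 32 : R)) = 1.
  exact: expRxMexpNx_1.
have e1 := expR_ge1Dx (n%:R / 32 : R).
have e2 := expR_ge0 (- (n%:R / 32 : R)).
apply: (@le_trans _ _ (expR (n%:R / 32 : R) * e * expR (- (n%:R / 32 : R)))).
  by rewrite ler_wpM2r// (le_trans _ (ler_wpM2r (ltW e0) e1))//; lra.
by rewrite mulrAC ee mul1r.
Qed.

(** * The crossing probability of Brownian motion *)

Section brownian_crossing.
Context (R : realType) (d : measure_display) (T : measurableType d).
Context (P : probability T R) (B : R -> {RV P >-> R}).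
Hypothesis HB : standard_brownian_motion B.

Lemma brownian_increment_mgf s t r : 0 <= s -> s < t ->
  (\int[P]_w (expR (r * (B t w - B s w)))%:E = (expR (r ^+ 2 * (t - s) / 2))%:E)%E.
Proof.
move=> s0 st; case: HB => _ _ _ /(_ s t s0 st) law.
have ts : 0 < t - s by rewrite subr_gt0.
have mD : measurable_fun [set: T] (fun w => B t w - B s w : measurableTypeR R).
  exact: measurable_funB (measurable_funPT _) (measurable_funPT _).
pose D : {RV P >-> measurableTypeR R} := RV_of P mD.
have -> : (\int[P]_w (expR (r * (B t w - B s w)))%:E =
    \int[distribution P D]_y (expR (r * y))%:E)%E.
  rewrite ge0_integral_distribution//=.
  have h : measurable_fun [set: R] (fun y : R => (expR (r * y))%:E).
    by apply/measurable_EFinP; apply: measurableT_comp.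
  exact: h.
rewrite -[t - s in RHS]sqr_sqrtr ?ltW//.
by apply: normal_mgf => [|A mA]; [rewrite sqrtr_gt0|exact: law].
Qed.

Definition crossing_event mu m n : set T :=
  [set w | dyadic_cross (fun t => B t w) mu m n].

Lemma crossing_event_error mu N (tau e : R) :
  0 < mu -> (0 < N)%N -> 0 <= tau -> 0 < e -> exists2 eps0 : R, 0 < eps0 &
  forall m n, (2 ^+ m)^-1 < eps0 -> n%:R * (2 ^+ m)^-1 = tau ->
  `|fine (P (crossing_event mu m n)) - doob N 0 mu| <=
    expR (- (N%:R * mu / 2)) + 4 * N%:R * expR (- (tau / 32)) + e.
Proof.
move=> mu0 N0 tau0 e0.
have [eps0 eps00 h] := hitting_limit P mu0 N0 tau0 e0.
exists eps0 => // m n meps ntau.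
pose X k : {RV P >-> R} := (B (dyadic R m k.+1) - B (dyadic R m k))%R.
have e2 : 0 < (2 ^+ m)^-1 :> R by rewrite invr_gt0 exprn_gt0.
have indX : mutually_independent P (fun i w => X i w).
  case: HB => _ _ + _; apply; first exact: dyadic_ge0.
  by move=> i j ij; exact: dyadic_homo.
have mgfX i s : (\int[P]_w (expR (s * X i w))%:E =
    (expR (s ^+ 2 * (2 ^+ m)^-1 / 2))%:E)%E.
  rewrite brownian_increment_mgf ?dyadic_ge0//; last first.
    by rewrite ltr_pM2r ?invr_gt0 ?exprn_gt0// ltr_nat.
  by rewrite /dyadic -mulrBl -natrB// subSnn mul1r.
have := h X _ n e2 meps ntau indX mgfX.
suff -> : fine (P (crossing_event mu m n)) =
  Ex P (fun w => if alive (2 ^+ m)^-1 mu (fun j => X j w) n then 0 else 1) by [].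
have mal : measurable_fun setT
    (fun w => ~~ alive (2 ^+ m)^-1 mu (fun j => X j w) n).
  apply: measurableT_comp => //.
  exact: (@measurable_alive _ _ _ P X (2 ^+ m)^-1 mu n).
have := Ex_ind P mal => E; rewrite (_ : crossing_event mu m n =
  [set w | ~~ alive (2 ^+ m)^-1 mu (fun j => X j w) n]).
  apply: etrans (congr1 fine (esym E)) _ => /=.
  by apply: eq_Rintegral => w _; case: ifP => [/negPf ->|/negbFE ->].
apply/seteqP; split => w /= hw.
  by apply/(not_aliveP _ mu (fun k => B (dyadic R m k) w)); exact: hw.
by have /(not_aliveP _ mu (fun k => B (dyadic R m k) w)) := hw.
Qed.

Lemma measurable_crossing_event mu m n : measurable (crossing_event mu m n).
Proof.
rewrite (_ : crossing_event mu m n = \bigcup_(i in `I_n.+1) \bigcup_(j in `I_i.+1)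
  [set w | mu + dyadic R m i / 4 <= B (dyadic R m i) w - B (dyadic R m j) w]).
  apply: bigcup_measurable => i _; apply: bigcup_measurable => j _.
  rewrite -[X in measurable X]setTI.
  have := @measurable_fun_ler _ T R setT (fun=> mu + dyadic R m i / 4)
    (fun w => B (dyadic R m i) w - B (dyadic R m j) w) (measurable_cst _).
  move=> /(_ (measurable_funB (measurable_funPT _) (measurable_funPT _))).
  by move=> /(_ measurableT [set true] I); rewrite setTI.
apply/seteqP; split => [w [i [j [ji in_ h]]]|w [i in_ [j ji h]]].
  by exists i => //; exists j.
by exists i, j.
Qed.

(** Horizon outside, mesh inside, with [t * 2 ^ m] steps up to time [t]: both unions increase, and
    the mesh is refined at a fixed horizon. *)
Definition crossing mu : set T := \bigcup_t \bigcup_m crossing_event mu m (t * 2 ^ m).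

Lemma crossingP mu w :
  crossing mu w <-> exists m n, dyadic_cross (fun t => B t w) mu m n.
Proof.
split=> [[t _ [m _ h]]|[m [n [i [j [ji in_ h]]]]]]; first by exists m, (t * 2 ^ m)%N.
exists n => //; exists m => //; exists i, j; split => //.
by rewrite (leq_trans in_)// leq_pmulr// expn_gt0.
Qed.

Lemma measurable_crossing mu : measurable (crossing mu).
Proof.
by do 2 apply: bigcupT_measurable => ?; exact: measurable_crossing_event.
Qed.

(** The mesh error dies in the inner union and the contribution of surviving paths in the outer one;
    the truncation error is what is left. *)
Lemma crossing_probability mu N : 0 < mu -> (0 < N)%N ->
  `|fine (P (crossing mu)) - doob N 0 mu| <= expR (- (N%:R * mu / 2)).
Proof.
move=> mu0 N0; apply: probability_limit.
- by move=> t; apply: bigcupT_measurable => m; exact: measurable_crossing_event.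
- move=> t t' tt'; apply/subsetPset => w [m _ [i [j [ji in_ h]]]].
  by exists m => //; exists i, j; split => //; rewrite (leq_trans in_)// leq_mul2r tt' orbT.
move=> e e0; have [t0 ht0] := expRN_small (4 * N%:R) e0.
exists t0 => t t0t.
apply: (@le_trans _ _ (expR (- (N%:R * mu / 2)) + 4 * N%:R * expR (- (t%:R / 32))));
  last by rewrite lerD2l; exact: ht0.
apply: probability_limit.
- by move=> m; exact: measurable_crossing_event.
- apply/nondecreasing_seqP => m; apply/subsetPset => w.
  by apply: dyadic_crossS; rewrite expnS mulnCA.
move=> e' e'0.
have [eps0 eps00 h] := crossing_event_error mu0 N0 (ler0n R t) e'0.
have [n0 hn0] := invX2_small eps00.
exists n0 => m n0m; apply: h; first exact: hn0.
by rewrite natrM natrX -mulrA divff ?mulr1// expf_neq0.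
Qed.

End brownian_crossing.

(** * Deterministic properties of reflected paths *)

Section path.
Context (R : realType) (b : R -> R).
Hypothesis cb : {within `[0, +oo[, continuous b}.

(** The affine term serves two uses: it is zero for the running supremum, and a constant minus the
    line for the hitting time. *)
Lemma drifted_continuous delta s c k (A : set R) : A `<=` `[0, +oo[%classic ->
  {within A, continuous (fun t => drifted b delta s t + c - k * t)}.
Proof.
move=> A0; apply/subspace_continuousP => x Ax.
have /subspace_continuousP/(_ x Ax) cbx := continuous_subspaceW A0 cb.
have cid : (fun t : R => t) @ within A (nbhs x) --> x by exact: cvg_within.
have cst_cvg (r : R) : (fun=> r) @ within A (nbhs x) --> r by exact: cvg_cst.
apply: cvgB; last exact: cvgM.
apply: cvgD => //; apply: cvgB => //; apply: cvgD => //.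
by apply: cvgM => //; exact: cvgB.
Qed.

Lemma drifted_start delta s : drifted b delta s s = 0.
Proof. by rewrite /drifted subrr mulr0 add0r subrr. Qed.

(* The running supremum is attained; this makes the reflected path explicit
   between the last point of the running infimum and the current time. *)
Lemma reflected_max delta s t : 0 <= s -> s <= t -> exists u,
  [/\ s <= u, u <= t,
   reflected b delta s t = drifted b delta s t + Num.max 0 (- drifted b delta s u) &
   forall v, s <= v -> v <= t ->
     Num.max 0 (- drifted b delta s v) <= Num.max 0 (- drifted b delta s u)].
Proof.
move=> s0 st.
have sub : `[s, t]%classic `<=` `[0, +oo[%classic.
  by move=> x /=; rewrite !in_itv/= andbT => /andP[sx _]; exact: le_trans sx.
have cf : {within `[s, t], continuous (fun u => - (drifted b delta s u + 0 - 0 * u))}.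
  move=> x; apply: cvgN; exact: drifted_continuous sub x.
have [u ust hu] := EVT_max st cf.
have fE v : drifted b delta s v + 0 - 0 * v = drifted b delta s v by ring.
have hmax v : s <= v -> v <= t ->
     Num.max 0 (- drifted b delta s v) <= Num.max 0 (- drifted b delta s u).
  move=> sv vt; have := hu v; rewrite !fE in_itv/= sv vt => /(_ isT) h.
  by rewrite ge_max !le_max lexx h orbT.
move: ust; rewrite in_itv/= => /andP[su ut].
exists u; split => //; congr (_ + _).
apply/eqP; rewrite eq_le; apply/andP; split.
  apply: ge_sup; first by exists (Num.max 0 (- drifted b delta s u)), u; rewrite //= in_itv/= su.
  by move=> _ [v /= + <-]; rewrite in_itv/= => /andP[]; exact: hmax.
apply: ub_le_sup; last by exists u => //=; rewrite in_itv/= su.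
exists (Num.max 0 (- drifted b delta s u)).
by move=> _ [v /= + <-]; rewrite in_itv/= => /andP[]; exact: hmax.
Qed.

Lemma reflected_ge delta s u t : 0 <= s -> s <= u -> u <= t ->
  delta * (t - u) + b t - b u <= reflected b delta s t.
Proof.
move=> s0 su ut; have st := le_trans su ut.
have [v [sv vt -> hv]] := reflected_max delta s0 st.
have : - drifted b delta s u <= Num.max 0 (- drifted b delta s v).
  by apply: le_trans (hv u su ut); rewrite le_max lexx orbT.
rewrite /drifted; move: (Num.max _ _) => m; nra.
Qed.

(** Continuity of the reflected path is bypassed. Once the running supremum has reached its final
    value [g], the path is [drifted] plus a constant; it starts from [0], below the line, and the
    intermediate value theorem applies. *)
Lemma reflected_hit delta s mu t1 : 0 <= s -> s <= t1 -> 0 < mu ->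
  line mu t1 <= reflected b delta s t1 ->
  exists t, [/\ s <= t, t <= t1 & reflected b delta s t = line mu t].
Proof.
move=> s0 st1 mu0; have [u [su ut1 -> hu]] := reflected_max delta s0 st1.
set g := Num.max 0 (- drifted b delta s u) in hu *; move=> hl.
(* If [g = 0] nothing is reflected and the path is followed from [s]; otherwise [drifted] equals
   [- g] at [u]. Either way the path is at [0] at [p]. *)
pose p := if g == 0 then s else u.
have sp : s <= p by rewrite /p; case: ifP.
have pt1 : p <= t1 by rewrite /p; case: ifP.
have p0 : 0 <= p by exact: le_trans sp.
have fp : drifted b delta s p + g = 0.
  rewrite /p; case: ifPn => [/eqP ->|]; first by rewrite drifted_start addr0.
  by rewrite /g; have [_|_] := leP 0 (- drifted b delta s u); rewrite ?eqxx// subrr.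
have refl_eq t : p <= t -> t <= t1 -> reflected b delta s t = drifted b delta s t + g.
  move=> pt tt1; have st := le_trans sp pt.
  have [v [sv vt -> hv]] := reflected_max delta s0 st; congr (_ + _).
  apply/eqP; rewrite eq_le (hu v sv (le_trans vt tt1))/=.
  move: (pt); rewrite /p; case: ifPn => [/eqP -> _|_ ut]; first by rewrite le_max lexx.
  exact: hv.
have sub : `[p, t1]%classic `<=` `[0, +oo[%classic.
  by move=> x /=; rewrite !in_itv/= andbT => /andP[px _]; exact: le_trans px.
have cf := @drifted_continuous delta s (g - mu) 4^-1 _ sub.
have [] := @IVT _ _ p t1 0 pt1 cf.
  apply/andP; split.
    rewrite ge_min; apply/orP; left; rewrite addrA fp; lra.
  rewrite le_max; apply/orP; right.
  by move: hl; rewrite /line; lra.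
move=> t; rewrite in_itv/= => /andP[pt tt1] ht.
exists t; split => //; first exact: le_trans pt.
rewrite refl_eq// /line; lra.
Qed.

Lemma hitting_time_fin mu delta s t : s <= t ->
  reflected b delta s t = line mu t ->
  exists2 r, s <= r & hitting_time b mu delta s%:E = r%:E.
Proof.
move=> st ht; rewrite /hitting_time.
set E := [set _ | _ in _].
have Es : (s%:E <= ereal_inf E)%E.
  by apply: le_ereal_inf_tmp => _ [r /= [sr _] <-]; rewrite lee_fin.
have Et : (ereal_inf E <= t%:E)%E by apply: ereal_inf_lbound; exists t.
case: (ereal_inf E) Es Et => [r| |]//= sr _.
by exists r.
Qed.

Lemma hitting_time_oo mu delta s :
  ~ (exists t, s <= t /\ reflected b delta s t = line mu t) ->
  hitting_time b mu delta s%:E = +oo%E.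
Proof.
move=> h; rewrite /hitting_time (_ : [set _ | _ in _] = set0) ?ereal_inf0//.
by apply/seteqP; split => // _ [t /= [st ht] _]; apply: h; exists t.
Qed.

Definition recurrent_path := forall s mu : R, 0 <= s -> exists u t,
  [/\ s <= u, u <= t & mu + u / 4 <= b t - b u].

(** Positivity is decided by [xi_plus] at [1]: if it is infinite so are all later ones, and if it is
    finite its atom already has mass [1]. Recurrence makes the second stage, of drift [1 / 4],
    succeed from any finite start. *)
Lemma nu_gt0 mu : recurrent_path -> 0 < mu ->
  (0 < nu b 0 mu setT)%E <-> exists t, 0 <= t /\ reflected b 0 0 t = line mu t.
Proof.
move=> rec mu0; have a0 : - 0 / 4 = 0 :> R by rewrite oppr0 mul0r.
have xiE : xi_plus b 0 mu 1 =
    hitting_time b mu ((0 + 1) / 4) (hitting_time b mu (- 0 / 4) 0%:E) by [].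
rewrite a0 in xiE; split=> [nu0|[t [t0 ht]]].
  apply: contrapT => h; move: nu0.
  have xi1 i : xi_plus b 0 mu i.+1 = +oo%E.
    elim: i => [|i IH]; last by rewrite [LHS]/= -/(xi_plus b 0 mu i.+1) IH.
    by rewrite xiE hitting_time_oo.
  by rewrite /nu eseries0 ?ltxx// => -[//|i] _; rewrite xi1.
have [s1 s10 xim] := hitting_time_fin t0 ht.
have [u [t1 [su ut1 h]]] := rec s1 mu s10.
have st1 := le_trans su ut1.
have lt1 : line mu t1 <= reflected b ((0 + 1) / 4) s1 t1.
  apply: le_trans (reflected_ge _ s10 su ut1); rewrite /line; lra.
have [t2 [st2 _ ht2]] := reflected_hit s10 st1 mu0 lt1.
have [s2 s20 xip] := hitting_time_fin st2 ht2.
have xi1 : xi_plus b 0 mu 1 = s2%:E by rewrite xiE xim xip.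
apply: (@lt_le_trans _ _ (\sum_(1 <= i < 2 | xi_plus b 0 mu i \is a fin_num)
     \d_(fine (xi_plus b 0 mu i)) [set: R])%E).
  by rewrite big_mkcond big_nat1 xi1/= diracT lte01.
by apply: nneseries_lim_ge.
Qed.

Lemma dyadic_cross_hit mu m n : 0 < mu -> dyadic_cross b mu m n ->
  exists t, 0 <= t /\ reflected b 0 0 t = line mu t.
Proof.
move=> mu0 [i [j [ji in_ h]]].
have d0 k : 0 <= dyadic R m k by rewrite divr_ge0// exprn_ge0.
have dji : dyadic R m j <= dyadic R m i.
  by rewrite ler_pM2r ?invr_gt0 ?exprn_gt0// ler_nat.
have : line mu (dyadic R m i) <= reflected b 0 0 (dyadic R m i).
  by apply: le_trans (reflected_ge 0 (lexx 0) (d0 j) dji); rewrite mul0r add0r.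
move=> /(reflected_hit (lexx 0) (d0 i) mu0)[t [t0 _ ht]].
by exists t.
Qed.

Lemma continuous_modulus x e : 0 <= x -> 0 < e -> exists2 r, 0 < r &
  forall y, 0 <= y -> y <= x -> x - r < y -> `|b x - b y| < e.
Proof.
move=> x0 e0; have /subspace_continuousP/(_ x) := cb.
rewrite /= in_itv/= x0 => /(_ isT)/cvgrPdist_lt/(_ e e0).
rewrite near_withinE => /nbhs_ballP[r /= r0 hr]; exists r => // y y0 yx xy.
apply: hr; last by rewrite /= in_itv/= y0.
by rewrite /ball/= ger0_norm ?subr_ge0//; lra.
Qed.

Definition dyadic_floor m (x : R) := dyadic R m (Num.trunc (x * 2 ^+ m)).

Lemma dyadic_floor_itv m x : 0 <= x ->
  x - (2 ^+ m)^-1 < dyadic_floor m x <= x.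
Proof.
move=> x0; have p2 : 0 < 2 ^+ m :> R by rewrite exprn_gt0.
have := truncn_itv (mulr_ge0 x0 (ltW p2)); rewrite /dyadic_floor /dyadic.
move: (Num.trunc _) => k /andP[h1 h2]; apply/andP; split.
  by rewrite ltr_pdivlMr// mulrBl mulVf ?gt_eqF// ltrBlDr natr1.
by rewrite ler_pdivrMr.
Qed.

(** Rounding [t] and [u] down to a fine grid lowers the line and moves [b] by less than
    [(mu - mu') / 2] at each of the two times, which the drop in level absorbs. *)
Lemma hit_dyadic_cross mu' mu t : mu' < mu -> 0 < mu -> 0 <= t ->
  reflected b 0 0 t = line mu t -> exists m n, dyadic_cross b mu' m n.
Proof.
move=> mumu mu0 t0 ht.
have [u [u0 ut hu]] : exists u, [/\ 0 <= u, u <= t & line mu t <= b t - b u].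
  have [u [u0 ut E _]] := reflected_max 0 (lexx 0) t0.
  move: ht; rewrite E; have [_|_] := leP 0 (- drifted b 0 0 u).
    by move=> <-; exists u; split=> //; rewrite /drifted; lra.
  by move=> <-; exists 0; split=> //; rewrite /drifted; lra.
pose e := (mu - mu') / 2; have e0 : 0 < e by rewrite divr_gt0// subr_gt0.
have [r1 r10 h1] := continuous_modulus t0 e0.
have [r2 r20 h2] := continuous_modulus u0 e0.
have [m1 hm1] := invX2_small r10; have [m2 hm2] := invX2_small r20.
pose m := maxn m1 m2.
have /andP[t1 t2] := dyadic_floor_itv m t0.
have /andP[u1 u2] := dyadic_floor_itv m u0.
have mr1 := hm1 m (leq_maxl _ _); have mr2 := hm2 m (leq_maxr _ _).
exists m, (Num.trunc (t * 2 ^+ m)), (Num.trunc (t * 2 ^+ m)), (Num.trunc (u * 2 ^+ m)).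
split => //; first by apply: le_truncn; rewrite ler_pM2r// exprn_gt0.
rewrite -/(dyadic_floor m t) -/(dyadic_floor m u).
have bt : `|b t - b (dyadic_floor m t)| < e.
  by apply: h1 => //; [exact: dyadic_ge0|lra].
have bu : `|b u - b (dyadic_floor m u)| < e.
  by apply: h2 => //; [exact: dyadic_ge0|lra].
move: bt bu; rewrite !ltr_norml => /andP[bt1 bt2] /andP[bu1 bu2].
move: hu; rewrite /line; move: bt1 bt2 bu1 bu2; rewrite /e; lra.
Qed.

End path.

(** * Large increments of Brownian motion recur *)

Section recurrence.
Context (R : realType) (d : measure_display) (T : measurableType d).
Context (P : probability T R) (B : R -> {RV P >-> R}).
Hypothesis HB : standard_brownian_motion B.

(* The increment of [B] from [sparse n] to [sparse n.+1] has standard deviation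
   [sparse n + n + 1], hence exceeds it with a probability independent of [n]. *)
Fixpoint sparse n : R :=
  if n is m.+1 then sparse m + (sparse m + m%:R + 1) ^+ 2 else 0.

Lemma sparse_ge n : n%:R <= sparse n.
Proof.
elim: n => //= n IH; rewrite -natr1.
have : 1 <= (sparse n + n%:R + 1) ^+ 2; last by lra.
have n0 : 0 <= n%:R :> R by [].
by rewrite expr_ge1//; lra.
Qed.

Let sigma n : R := sparse n + n%:R + 1.

Lemma sparse_step_gt0 n : 0 < sigma n.
Proof. by have n0 : 0 <= n%:R :> R by []; have := sparse_ge n; rewrite /sigma; lra. Qed.

Let X n : {RV P >-> R} := (B (sparse n.+1) - B (sparse n))%R.

Let below k : set T := [set w | forall n, (k <= n)%N -> X n w < sigma n].

Let measurable_lt n : measurable (X n @^-1` `]-oo, sigma n[%classic).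
Proof. by rewrite -[X in measurable X]setTI; exact: measurable_funPT. Qed.

Let belowE k : below k = \bigcap_(n in [set n | (k <= n)%N]) X n @^-1` `]-oo, sigma n[%classic.
Proof.
by apply/seteqP; split => w h n kn /=; have := h n kn; rewrite /= in_itv/=.
Qed.

Let measurable_below k : measurable (below k).
Proof. by rewrite belowE; apply: bigcap_measurable => //; exists k => /=. Qed.

(** Each increment stays under its threshold with probability at most [1 - p]; by independence [m]
    of them do so with probability at most [(1 - p) ^+ m]. *)
Let prob_below k : P (below k) = 0%E.
Proof.
have [p p0 hp] := normal_prob_tail R.
have sparse0 n : 0 <= sparse n by rewrite (le_trans _ (sparse_ge n)).
have stepE n : sparse n.+1 - sparse n = sigma n ^+ 2 by rewrite /= /sigma; ring.
have indX : mutually_independent P (fun i w => X i w).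
  case: HB => _ _ + _; apply => //; apply/nondecreasing_seqP => n.
  by rewrite -subr_ge0 stepE sqr_ge0.
have PX n : (P (X n @^-1` `]-oo, sigma n[%classic) <= (1 - p)%:E)%E.
  case: HB => _ _ _ /(_ (sparse n) (sparse n.+1) (sparse0 n)).
  have lt_sp : sparse n < sparse n.+1.
    by rewrite -subr_gt0 stepE exprn_gt0// sparse_step_gt0.
  move=> /(_ lt_sp `[sigma n, +oo[%classic (measurable_itv _)).
  rewrite stepE sqrtr_sqr gtr0_norm ?sparse_step_gt0// => PE.
  have -> : X n @^-1` `]-oo, sigma n[%classic =
      ~` ((fun w => B (sparse n.+1) w - B (sparse n) w) @^-1` `[sigma n, +oo[%classic).
    apply/seteqP; split => w /=; rewrite !in_itv/= andbT.
      by move=> h; apply/negP; rewrite -ltNge.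
    by move/negP; rewrite -ltNge.
  have mg : measurable ((fun w => B (sparse n.+1) w - B (sparse n) w)
      @^-1` `[sigma n, +oo[%classic).
    have : measurable (X n @^-1` `[sigma n, +oo[%classic); last by [].
    by rewrite -[Y in measurable Y]setTI; exact: measurable_funPT.
  rewrite probability_setC// PE EFinB.
  by rewrite leeB// hp// sparse_step_gt0.
have p1 : 0 <= 1 - p.
  by rewrite -lee_fin (le_trans _ (PX 0%N)).
pose fix J m : {fset nat} := if m is m'.+1 then ((k + m')%N |` J m')%fset else fset0.
have JP m i : i \in J m -> (k <= i < k + m)%N.
  elim: m => [|m IH] /=; first by rewrite inE.
  rewrite in_fset1U => /orP[/eqP ->|/IH/andP[-> ltm]].
    by rewrite leq_addr addnS ltnS leqnn.
  by rewrite addnS ltnS ltnW.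
have PJ m : (P (below k) <= ((1 - p) ^+ m)%:E)%E.
  apply: (@le_trans _ _ (P (\bigcap_(i in [set` J m]) (X i @^-1` `]-oo, sigma i[%classic)))).
    apply: le_measure; rewrite ?inE//.
      by apply: fin_bigcap_measurable => // i _; exact: measurable_lt.
    rewrite belowE => w h i /= /JP /andP[ki _]; exact: h.
  rewrite indX//; elim: m => [|m IH] /=; first by rewrite big_seq_fset0 expr0.
  rewrite big_fsetU1/=; last by apply/negP => /JP; rewrite ltnn andbF.
  have -> : ((1 - p) ^+ m.+1)%:E = ((1 - p)%:E * ((1 - p) ^+ m)%:E)%E.
    by rewrite -EFinM -exprS.
  apply: lee_pmul => //; first by apply: prode_ge0 => i _.
  exact: PX.
have cJ : (1 - p) ^+ m @[m --> \oo] --> 0.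
  by apply: cvg_expr; rewrite ger0_norm//; lra.
apply/eqP; rewrite eq_le measure_ge0 andbT.
apply/lee_addgt0Pr => e e0; rewrite add0e.
have /cvgrPdist_lt/(_ e e0)[m _ /(_ m (leqnn m))] := cJ.
rewrite sub0r normrN ger0_norm ?exprn_ge0// => /ltW h.
by rewrite (le_trans (PJ m)).
Qed.

Lemma ae_recurrent : {ae P, forall w, recurrent_path (fun t => B t w)}.
Proof.
have : {ae P, forall w, forall k, exists2 n, (k <= n)%N & sigma n <= X n w}.
  apply: ae_foralln => k; exists (below k); split; [exact: measurable_below|exact: prob_below|].
  move=> w /= h n kn; rewrite ltNge; apply/negP => hn.
  by apply: h; exists n.
apply: filterS => w h s mu s0.
(* Both [s] and [mu] are then below [n <= sparse n], so the increment starts after [s], and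
   [sparse n + n + 1] exceeds [mu + sparse n / 4]. *)
have [n kn hn] := h (maxn (Num.bound s) (Num.bound `|mu|)).
have sn : s < n%:R.
  rewrite (lt_le_trans (archi_boundP s0))// ler_nat.
  by rewrite (leq_trans _ kn)// leq_maxl.
have mun : mu < n%:R.
  rewrite (le_lt_trans (ler_norm mu))//.
  rewrite (lt_le_trans (archi_boundP (normr_ge0 mu)))// ler_nat.
  by rewrite (leq_trans _ kn)// leq_maxr.
have spn := sparse_ge n; have n0 : 0 <= n%:R :> R by [].
exists (sparse n), (sparse n.+1); split; first by lra.
  by rewrite /= lerDl sqr_ge0.
by apply: le_trans hn; rewrite /sigma; lra.
Qed.

End recurrence.

(** * Exponential laws and partial fractions *)

Section exponential_law.
Context (R : realType).
Implicit Types a r x : R.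

(** The survival function on the whole line: negative arguments arise in the convolution, when the
    new summand alone exceeds the level. *)
Definition exp_tail a x : R := if x < 0 then 1 else expR (- (a * x)).

Lemma exp_tail_ge0 a x : 0 <= exp_tail a x.
Proof. by rewrite /exp_tail; case: ifP. Qed.

Lemma measurable_exp_tail a : measurable_fun setT (exp_tail a).
Proof.
apply: measurable_fun_ifT => //; first exact: measurable_fun_ltr.
by apply: measurableT_comp => //; apply: measurableT_comp.
Qed.

Lemma exponential_prob_le r x : 0 <= x ->
  exponential_prob r `]-oo, x]%classic = (1 - expR (- (r * x)))%:E.
Proof.
move=> x0; rewrite /exponential_prob.
pose D : set R := `[0, x]%classic.
transitivity (\int[lebesgue_measure]_(y in D) (exponential_pdf r y)%:E)%E.
  rewrite integral_mkcond [RHS]integral_mkcond; apply: eq_integral => y _.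
  rewrite /D !patchE !mem_setE !in_itv/=.
  have [y0|y0] := leP 0 y; first by [].
  by rewrite lt0_exponential_pdf//; case: ifP.
rewrite /D; move: x0; rewrite le_eqVlt => /predU1P[<-|x0].
  by rewrite set_itv1 integral_set1 mulr0 oppr0 expR0 subrr.
by rewrite -/(exponential_prob _ _) exponential_prob_itv0c// mulNr EFinB.
Qed.

Lemma exponential_tail (nu : probability (measurableTypeR R) R) r x : 0 < r ->
  (forall A, measurable A -> nu A = exponential_prob r A) ->
  nu `]x, +oo[%classic = (exp_tail r x)%:E.
Proof.
move=> r0 nuE; have mle y : measurable (`]-oo, y]%classic : set (measurableTypeR R)).
  exact: measurable_itv.
rewrite -setCitvl probability_setC// nuE// /exp_tail.
have [x0|x0] := ltP x 0.
  rewrite /exponential_prob integral0_eq ?sube0// => y /=.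
  by rewrite in_itv/= => yx; rewrite lt0_exponential_pdf// (le_lt_trans yx).
by rewrite exponential_prob_le// -EFinB; congr EFin; ring.
Qed.

Lemma exponential_convolution (nu : probability (measurableTypeR R) R)
    a r x : 0 < a -> a < r ->
  (forall A, measurable A -> nu A = exponential_prob r A) ->
  (\int[nu]_y (exp_tail a (x - y))%:E =
   ((r * exp_tail a x - a * exp_tail r x) / (r - a))%:E)%E.
Proof.
move=> a0 ar nuE; have r0 := lt_trans a0 ar.
have ra0 : 0 < r - a by rewrite subr_gt0.
have mpdf c : measurable_fun [set: measurableTypeR R]
    (fun y => (exponential_pdf c y)%:E).
  by apply/measurable_EFinP; exact: measurable_exponential_pdf.
rewrite (@ge0_integral_density _ _ R lebesgue_measure nu (exponential_pdf r))//.
- have [x0|x0] := ltP x 0.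
    transitivity (\int[lebesgue_measure]_y (exponential_pdf r y)%:E)%E.
      apply: eq_integral => y _; rewrite /exp_tail.
      have [y0|y0] := ltP y 0; first by rewrite lt0_exponential_pdf// mule0.
      by rewrite ifT ?mul1e//; lra.
    rewrite integral_exponential_pdf// /exp_tail x0; congr EFin; field.
    exact: lt0r_neq0.
  (* For [y] between [0] and [x], [expR (- (a * (x - y)))] times the density of rate [r] is [c]
     times the density of rate [r - a]. *)
  pose c := expR (- (a * x)) * (r / (r - a)).
  have c_ge0 : 0 <= c by rewrite mulr_ge0// divr_ge0// ltW.
  pose D : set R := `]-oo, x]%classic; pose D' : set R := `]x, +oo[%classic.
  transitivity (\int[lebesgue_measure]_y
      (c%:E * ((exponential_pdf (r - a) \_ D) y)%:E +
       ((exponential_pdf r \_ D') y)%:E))%E.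
    apply: eq_integral => y _; rewrite -!EFinM -EFinD; congr EFin.
    rewrite /D /D' !patchE !mem_setE !in_itv/= andbT /exp_tail subr_lt0.
    have [yx|xy] := leP y x; last by rewrite mulr0 add0r mul1r.
    rewrite addr0; have [y0|y0] := ltP y 0.
      by rewrite !lt0_exponential_pdf// !mulr0.
    rewrite !exponential_pdfE// /c.
    rewrite (_ : expR (- r * y) = expR (- (a * y)) * expR (- (r - a) * y)).
      rewrite (_ : - (a * (x - y)) = - (a * x) - - (a * y)); last by ring.
      rewrite expRB; field; rewrite !lt0r_neq0 ?expR_gt0//.
    by rewrite -expRD; congr expR; ring.
  have mr b (E : set R) : measurable E -> 0 < b ->
      measurable_fun [set: measurableTypeR R] (fun y => ((exponential_pdf b \_ E) y)%:E).
    move=> mE b0; apply/measurable_EFinP.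
    apply/(measurable_restrictT _ mE)/measurable_funTS.
    exact: measurable_exponential_pdf.
  have r_ge0 b (E : set R) y : 0 < b -> (0 <= ((exponential_pdf b \_ E) y)%:E)%E.
    by move=> b0; rewrite lee_fin patchE; case: ifP => // _; rewrite exponential_pdf_ge0// ltW.
  have E1 b (E : set R) : (\int[lebesgue_measure]_y ((exponential_pdf b \_ E) y)%:E =
      exponential_prob b E)%E.
    rewrite /exponential_prob [RHS]integral_mkcond; apply: eq_integral => y _.
    by rewrite !patchE; case: ifP.
  have mD : measurable D by exact: measurable_itv.
  have mD' : measurable D' by exact: measurable_itv.
  rewrite ge0_integralD//=.
  + rewrite ge0_integralZl//.
    * rewrite !E1 -nuE// exponential_prob_le// (exponential_tail _ r0 nuE).
      rewrite -EFinM -EFinD /exp_tail ltNge x0/=; congr EFin; rewrite /c.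
      rewrite (_ : expR (- (r * x)) = expR (- (a * x)) * expR (- ((r - a) * x))).
        by field; exact: lt0r_neq0.
      by rewrite -expRD; congr expR; ring.
    * exact: mr.
    * by move=> y _; exact: r_ge0.
  + by move=> y _; rewrite mule_ge0// r_ge0.
  + by apply: measurable_funeM; exact: mr.
  + by move=> y _; exact: r_ge0.
  + exact: mr.
- by move=> y; rewrite exponential_pdf_ge0// ltW.
- exact: measurable_exponential_pdf.
- have h : measurable_fun [set: R] (fun y => (exp_tail a (x - y))%:E).
    apply/measurable_EFinP; apply: (measurableT_comp (measurable_exp_tail a)).
    exact: measurable_funB.
  exact: h.
- by move=> y; rewrite lee_fin exp_tail_ge0.
Qed.

(** For [m <= n] this is [n! ^ 2 / ((n - m)! (n + m)!)], written so that each factor visibly tends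
    to [1] as [n] grows. *)
Definition rho n m : R := \prod_(k < m) ((n%:R - k%:R) / (n%:R + k%:R + 1)).

Lemma rhoS n m : rho n m.+1 = rho n m * ((n%:R - m%:R) / (n%:R + m%:R + 1)).
Proof. by rewrite /rho big_ord_recr. Qed.

Let den_gt0 n m : 0 < n%:R + m%:R + 1 :> R.
Proof. by rewrite ltr_wpDl// addr_ge0. Qed.

Lemma rho_succ n m :
  rho n.+1 m * ((n.+1%:R - m%:R) * (n.+1%:R + m%:R)) = rho n m * n.+1%:R ^+ 2.
Proof.
elim: m => [|m IH]; first by rewrite /rho !big_ord0; ring.
have d1 := den_gt0 n m; have d2 := den_gt0 n.+1 m.
rewrite !rhoS.
have -> : rho n m * ((n%:R - m%:R) / (n%:R + m%:R + 1)) * n.+1%:R ^+ 2 =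
   rho n m * n.+1%:R ^+ 2 * ((n%:R - m%:R) / (n%:R + m%:R + 1)) by ring.
rewrite -IH -!natr1; field.
by rewrite !gt_eqF//=; move: d1 d2; rewrite -?natr1; lra.
Qed.

(** For [j < n], the partial fraction weight: the product of [i ^ 2 / (i ^ 2 - (j + 1) ^ 2)] over
    [1 <= i <= n], [i] different from [j + 1]. *)
Definition hypo n j : R := 2 * (-1) ^+ j * rho n j.+1.

Lemma hypo_sum n : (0 < n)%N -> \sum_(j < n) hypo n j = 1.
Proof.
move=> n0; have nR : 0 < n%:R :> R by rewrite ltr0n.
(* A closed form for the remainder, which vanishes at [m = n]. *)
suff H m : 1 - \sum_(j < m) hypo n j = (-1) ^+ m * rho n m * ((n%:R - m%:R) / n%:R).
  by apply/eqP; rewrite eq_sym -subr_eq0 H subrr mul0r mulr0.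
elim: m => [|m IH]; first by rewrite big_ord0 /rho big_ord0 expr0; field; exact: lt0r_neq0.
have d := den_gt0 n m.
rewrite big_ord_recr/= opprD addrA IH /hypo rhoS exprS -!natr1; field.
by rewrite !lt0r_neq0.
Qed.

Lemma hypo_succ n j : (j < n)%N ->
  hypo n.+1 j = hypo n j * n.+1%:R ^+ 2 / (n.+1%:R ^+ 2 - j.+1%:R ^+ 2).
Proof.
move=> jn; have := rho_succ n j.+1.
have h : 0 < n.+1%:R - j.+1%:R :> R by rewrite subr_gt0 ltr_nat ltnS.
have h2 : 0 < n.+1%:R + j.+1%:R :> R by rewrite addr_gt0.
move=> E; rewrite /hypo -[in RHS](mulrA (2 * (-1) ^+ j)) -E subr_sqr.
by rewrite [in RHS]mulrA mulfK// mulf_neq0 ?lt0r_neq0.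
Qed.

Lemma rho_le1 n m : (m <= n)%N -> 0 <= rho n m <= 1.
Proof.
elim: m => [|m IH] mn; first by rewrite /rho big_ord0 ler01 lexx.
have /andP[r0 r1] := IH (ltnW mn); have d := den_gt0 n m.
have mn' : m%:R <= n%:R :> R by rewrite ler_nat ltnW.
have f0 : 0 <= (n%:R - m%:R) / (n%:R + m%:R + 1) :> R.
  by rewrite divr_ge0 ?subr_ge0// ltW.
have f1 : (n%:R - m%:R) / (n%:R + m%:R + 1) <= 1 :> R.
  have m0 : 0 <= m%:R :> R by [].
  by rewrite ler_pdivrMr// mul1r; lra.
by rewrite rhoS mulr_ge0//= mulr_ile1.
Qed.

Lemma rho_cvg m : rho n m @[n --> \oo] --> (1 : R).
Proof.
elim: m => [|m IH].
  by under eq_fun do rewrite /rho big_ord0; exact: cvg_cst.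
under eq_fun do rewrite rhoS.
suff h : (n%:R - m%:R) / (n%:R + m%:R + 1) @[n --> \oo] --> (1 : R).
  by have := cvgM IH h; rewrite mulr1; exact.
have c0 : (2 * m%:R + 1) * harmonic n @[n --> \oo] --> (0 : R).
  by have := cvgM (cvg_cst (2 * m%:R + 1 : R)) (@cvg_harmonic R); rewrite mulr0; exact.
have c1 : 1 - (2 * m%:R + 1) * harmonic n @[n --> \oo] --> (1 : R).
  by have := cvgB (cvg_cst (1 : R)) c0; rewrite subr0; exact.
suff nr : \forall n \near \oo, 1 - (2 * m%:R + 1) * harmonic n <= (
    (n%:R - m%:R) / (n%:R + m%:R + 1) : R) <= (1 : R).
  by apply: (squeeze_cvgr nr c1); exact: cvg_cst.
near=> n.
have d := den_gt0 n m; have m0 : 0 <= m%:R :> R by [].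
have n1 : 0 < n.+1%:R :> R by [].
apply/andP; split; last by rewrite ler_pdivrMr// mul1r; lra.
rewrite ler_pdivlMr// /harmonic.
rewrite (_ : n%:R - m%:R = (n%:R + m%:R + 1) - (2 * m%:R + 1)); last by ring.
rewrite mulrBl mul1r lerD2l lerN2 -[leLHS]mulr1 -[leRHS]mulrA ler_wpM2l//.
by rewrite ler_pdivlMl// mulr1 -natr1; lra.
Unshelve. all: by end_near.
Qed.

End exponential_law.

(** * Tails of the partial sums *)

Section hypoexponential.
Context (R : realType) (d : measure_display) (T : measurableType d).
Context (P : probability T R) (g : nat -> {RV P >-> R}).
Hypothesis indg : mutually_independent P (fun j w => g j w).
Hypothesis lawg : forall (j : nat) (A : set R), measurable A ->
  distribution P (g j) A = exponential_prob (j.+1%:R ^+ 2 / 2) A.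

Let lam j : R := j.+1%:R ^+ 2 / 2.

Let S n w : R := \sum_(i < n) g i w.

Let mG j : measurable_fun [set: T] (fun w => g j w : measurableTypeR R).
Proof. by have h : measurable_fun [set: T] (g j) by []; exact: h. Qed.

Let G j : {RV P >-> measurableTypeR R} := RV_of P (@mG j).

Let lawG j A : measurable A -> distribution P (G j) A = exponential_prob (lam j) A.
Proof. by move=> mA; exact: lawg. Qed.

Let lam_gt0 j : 0 < lam j.
Proof. by rewrite divr_gt0// exprn_gt0. Qed.

Let lam_lt i j : (i < j)%N -> lam i < lam j.
Proof. by move=> ij; rewrite ltr_pM2r// ltrXn2r// ltr_nat ltnS. Qed.

Let S_past n : measurable_fun (setT : set (past g n)) (S n).
Proof.
apply: (@measurable_sum _ (past g n) _ setT _ _ (fun (i : 'I_n) w => g i w)) => i.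
exact: measurable_past.
Qed.

Let measurable_S n : measurable_fun setT (S n).
Proof. by apply: (@past_measurable_fun _ _ _ P g n); exact: S_past. Qed.

Let measurable_gtS n x : measurable [set w | x < S n w].
Proof.
have := measurable_fun_ltr (measurable_cst x) (measurable_S n).
by move=> /(_ measurableT [set true] I); rewrite setTI.
Qed.

Definition hypo_tail n x : R := \sum_(j < n) hypo R n j * exp_tail (lam j) x.

Let Ex_exp_tail n j x : (j < n)%N ->
  L1 P (fun w => exp_tail (lam j) (x - g n w)) /\
  Ex P (fun w => exp_tail (lam j) (x - g n w)) =
  (lam n * exp_tail (lam j) x - lam j * exp_tail (lam n) x) / (lam n - lam j).
Proof.
move=> jn; apply: L1_ge0.
- apply: (measurableT_comp (measurable_exp_tail _)); exact: measurable_funB.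
- by move=> w; exact: exp_tail_ge0.
rewrite -(exponential_convolution x (lam_gt0 j) (lam_lt jn) (@lawG n)).
rewrite ge0_integral_distribution//=; last by move=> y; rewrite lee_fin exp_tail_ge0.
have h : measurable_fun [set: R] (fun y => (exp_tail (lam j) (x - y))%:E).
  apply/measurable_EFinP; apply: (measurableT_comp (measurable_exp_tail _)).
  exact: measurable_funB.
exact: h.
Qed.

(** Old and new weights both sum to [1], so the weight of the new rate is the sum of the differences
    between old and new weights. This spreads it over the convolution terms, which then match one by
    one. *)
Lemma hypo_tailS n x : (0 < n)%N -> hypo_tail n.+1 x = \sum_(j < n) hypo R n j *
  ((lam n * exp_tail (lam j) x - lam j * exp_tail (lam n) x) / (lam n - lam j)).
Proof.
move=> n0; rewrite /hypo_tail big_ord_recr/=.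
have := hypo_sum R (ltn0Sn n); rewrite big_ord_recr/= => s1.
have s2 := hypo_sum R n0.
have -> : hypo R n.+1 n = \sum_(j < n) (hypo R n j - hypo R n.+1 j).
  by rewrite sumrB s2 -s1 addrAC subrr add0r.
rewrite mulr_suml -big_split/=; apply: eq_bigr => j _.
have h : 0 < n.+1%:R ^+ 2 - j.+1%:R ^+ 2 :> R.
  by rewrite subr_gt0 ltrXn2r// ltr_nat ltnS.
rewrite hypo_succ// /lam; move: (n.+1%:R ^+ 2) (j.+1%:R ^+ 2) h => y z h.
have -> : y / 2 - z / 2 = (y - z) / 2 by field.
field; exact: lt0r_neq0.
Qed.

(** Conditioning on the last summand, which is independent of the others, convolves the tail with
    its law, and the convolution acts on each exponential separately. *)
Lemma hypoexponential_law n x : (0 < n)%N ->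
  P [set w | x < S n w] = (hypo_tail n x)%:E.
Proof.
case: n => // n _; elim: n x => [|n IH] x.
  have := hypo_sum R (ltn0Sn 0); rewrite big_ord1 => h1.
  rewrite /hypo_tail big_ord1 h1 mul1r.
  rewrite -(exponential_tail x (lam_gt0 0) (@lawG 0)) /distribution/= /pushforward/=.
  by congr (P _); apply/seteqP; split => w /=; rewrite /S big_ord1 in_itv/= andbT.
pose D := [set z : R * R | x < z.1 + z.2].
have mD : measurable D.
  have := measurable_fun_ltr (measurable_cst x)
    (measurable_funD (@measurable_fst _ _ R R) (@measurable_snd _ _ R R)).
  by move=> /(_ measurableT [set true] I); rewrite setTI.
pose f (z : R * R) : \bar R := (\1_D z)%:E.
have mf : measurable_fun [set: R * R] f.
  by apply/measurable_EFinP; exact: measurable_indic.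
have f0 z : (0 <= f z)%E by rewrite lee_fin.
pose SR : {RV P >-> R} := RV_of P (measurable_S n.+1).
have iSg : indep2 P SR (g n.+1) by apply: indep2_past => //; exact: S_past.
transitivity (\int[P]_w f (SR w, g n.+1 w))%E.
  rewrite -[X in P X]setIT -integral_indic//.
  apply: eq_integral => w _; rewrite /f !indicE; congr ((nat_of_bool _)%:R%:E).
  apply/idP/idP; rewrite !inE /D /= /S (big_ord_recr n.+1)/=; exact.
rewrite (indep2_integral iSg mf f0).
pose q (y : R) : \bar R := (hypo_tail n.+1 (x - y))%:E.
have mq : measurable_fun [set: R] q.
  apply/measurable_EFinP.
  apply: (@measurable_sum _ R R setT _ _
    (fun (j : 'I_n.+1) (y : R) => hypo R n.+1 j * exp_tail (lam j) (x - y))) => j.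
  apply: measurable_funM => //; apply: (measurableT_comp (measurable_exp_tail _)).
  exact: measurable_funB.
have q0 y : (0 <= q y)%E by rewrite /q -IH.
transitivity (\int[distribution P (g n.+1)]_y q y)%E.
  apply: eq_integral => y _; rewrite /q -IH.
  rewrite ge0_integral_distribution//=; last first.
    exact: measurableT_comp mf (measurable_pair2 y).
  rewrite -[X in P X]setIT -integral_indic//.
  apply: eq_integral => w _; rewrite /f !indicE; congr ((nat_of_bool _)%:R%:E).
  by apply/idP/idP; rewrite !inE /D /= ltrBlDr.
rewrite ge0_integral_distribution//.
have lE (j : 'I_n.+1) := @Ex_exp_tail n.+1 j x (ltn_ord j).
have lZ (j : 'I_n.+1) := L1Z (hypo R n.+1 j) (lE j).1.
rewrite hypo_tailS// -(eq_bigr _ (fun (j : 'I_n.+1) _ =>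
  congr1 (fun t => hypo R n.+1 j * t) (lE j).2)).
rewrite -(eq_bigr _ (fun (j : 'I_n.+1) _ => ExZ _ (lE j).1)) -Ex_sum//.
have lS : P.-integrable setT (EFin \o (fun w => \sum_(j < n.+1)
    hypo R n.+1 j * exp_tail (lam j) (x - g n.+1 w))) := L1_sum _ lZ.
rewrite /Ex /Rintegral fineK//; exact: integrable_fin_num.
Qed.

(** The first [N] weights converge. The others have modulus at most [2], and [lam j >= j / 2], so a
    geometric series of ratio [expR (- (x / 2))] bounds the rest uniformly in [n]. *)
Lemma hypo_tail_doob x N e : 0 < x -> (0 < N)%N -> 0 < e ->
  exists n0, forall n, (n0 <= n)%N -> `|hypo_tail n x - doob N 0 x| <=
    2 * (expR (- (x / 2)) ^+ N / (1 - expR (- (x / 2)))) + e.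
Proof.
move=> x0 N0 e0; set r := expR _.
have r0 : 0 < r by exact: expR_gt0.
have r1 : r < 1 by rewrite expR_lt1 oppr_lt0 divr_gt0.
have r_le j : expR (- (lam j * x)) <= r ^+ j.
  rewrite /r -expRM_natl ler_expR mulrN lerN2 /lam -(natr1 j).
  have j0 : 0 <= j%:R :> R by [].
  have : 0 <= j%:R * (j%:R * x) by rewrite !mulr_ge0// ltW.
  have : 0 <= j%:R * x by rewrite mulr_ge0// ltW.
  rewrite sqrrD expr2; lra.
have tailE j : exp_tail (lam j) x = expR (- (lam j * x)).
  by rewrite /exp_tail ltNge (ltW x0).
pose u n : R := \sum_(k < N) hypo R n k * expR (- (lam k * x)).
have cu : u n @[n --> \oo] --> doob N 0 x.
  rewrite (_ : doob N 0 x = \sum_(k < N) 2 * (-1) ^+ k * 1 * expR (- (lam k * x))); last first.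
    apply: eq_bigr => k _; rewrite mulr0 ch0 !mulr1; congr (_ * expR _).
    by rewrite /lam; ring.
  rewrite /u; elim: (index_enum _) => [|k s IH].
    by rewrite big_nil; under eq_fun do rewrite big_nil; exact: cvg_cst.
  rewrite big_cons; under eq_fun do rewrite big_cons.
  apply: cvgD => //; apply: cvgM; last exact: cvg_cst.
  by apply: cvgM; [exact: cvg_cst|exact: rho_cvg].
have /cvgrPdist_le/(_ e e0)[n1 _ hn1] := cu.
exists (maxn n1 N) => n; rewrite geq_max => /andP[n1n Nn].
have split_ : hypo_tail n x = u n + \sum_(N <= j < n) hypo R n j * expR (- (lam j * x)).
  rewrite /hypo_tail /u -(big_mkord xpredT (fun j => hypo R n j * exp_tail (lam j) x)).
  rewrite (@big_cat_nat _ _ _ N)//= big_mkord; congr (_ + _).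
    by apply: eq_bigr => j _; rewrite tailE.
  by apply: eq_bigr => j _; rewrite tailE.
have geo : \sum_(N <= j < n) r ^+ j <= r ^+ N / (1 - r).
  rewrite ler_pdivlMr ?subr_gt0//.
  have -> : (\sum_(N <= j < n) r ^+ j) * (1 - r) = r ^+ N - r ^+ n.
    rewrite mulr_suml -(opprK (r ^+ N - _)) opprB -telescope_sumr// -sumrN.
    by apply: eq_bigr => j _; rewrite exprS; ring.
  by rewrite lerBlDr lerDl exprn_ge0// ltW.
have tail_le : `|\sum_(N <= j < n) hypo R n j * expR (- (lam j * x))| <=
    2 * (r ^+ N / (1 - r)).
  apply: (le_trans (ler_norm_sum _ _ _)).
  apply: (@le_trans _ _ (2 * \sum_(N <= j < n) r ^+ j)); last by rewrite ler_pM2l.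
  rewrite mulr_sumr big_nat [leRHS]big_nat; apply: ler_sum => j /andP[_ jn].
  rewrite normrM (ger0_norm (expR_ge0 _)); apply: ler_pM => //.
  rewrite /hypo !normrM normrX normrN1 expr1n mulr1 ger0_norm//.
  have /andP[h0 h1] := @rho_le1 R n j.+1 jn.
  by rewrite ger0_norm// -[leRHS]mulr1 ler_pM2l.
have h := hn1 n n1n; rewrite distrC in h.
rewrite split_ addrAC; apply: (le_trans (ler_normD _ _)).
by rewrite [leLHS]addrC; apply: lerD.
Qed.

End hypoexponential.

Lemma ae_le_measure (d : measure_display) (T : measurableType d) (R : realType)
    (P : probability T R) (A B : set T) : measurable A -> measurable B ->
  {ae P, forall w, A w -> B w} -> (P A <= P B)%E.
Proof.
move=> mA mB [N [mN PN hN]].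
apply: (@le_trans _ _ (P (B `|` N))).
  apply: le_measure; rewrite ?inE//; first exact: measurableU.
  move=> w Aw; have [Bw|nB] := pselect (B w); [by left|right].
  by apply: hN => /= h; exact: nB (h Aw).
rewrite (le_trans (measureU2 _ mB mN))//.
by rewrite [X in (_ + X)%E](_ : _ = 0%E) ?adde0//; exact: PN.
Qed.

(** * The sum of the exponential series *)

Section exponential_series.
Context (R : realType) (d : measure_display) (T : measurableType d).
Context (P : probability T R) (g : nat -> {RV P >-> R}).
Hypothesis indg : mutually_independent P (fun j w => g j w).
Hypothesis lawg : forall (j : nat) (A : set R), measurable A ->
  distribution P (g j) A = exponential_prob (j.+1%:R ^+ 2 / 2) A.

Let S n w : R := \sum_(i < n) g i w.

Let seriesS w : series (fun j => g j w : R) = (fun n => S n w).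
Proof. by rewrite seriesEord. Qed.

Let measurable_S n : measurable_fun setT (S n).
Proof.
exact: (@measurable_sum _ T _ setT _ _ (fun (i : 'I_n) w => g i w)).
Qed.

Let measurable_gtS n x : measurable [set w | x < S n w].
Proof.
have := measurable_fun_ltr (measurable_cst x) (measurable_S n).
by move=> /(_ measurableT [set true] I); rewrite setTI.
Qed.

Lemma ae_exponential_gt0 : {ae P, forall w, forall j, 0 < g j w}.
Proof.
apply: ae_foralln => j; exists (g j @^-1` `]-oo, 0]%classic); split.
- by rewrite -[X in measurable X]setTI; exact: measurable_funPT.
- have := @lawg j `]-oo, 0]%classic (measurable_itv _).
  by rewrite exponential_prob_le// mulr0 oppr0 expR0 subrr.
- by move=> w /= /negP; rewrite -leNgt in_itv.
Qed.

Definition exceeds x : set T := [set w | exists n, x < \sum_(i < n) g i w].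

Lemma measurable_exceeds x : measurable (exceeds x).
Proof.
rewrite (_ : exceeds x = \bigcup_n [set w | x < S n w]).
  by apply: bigcupT_measurable.
by apply/seteqP; split => [w [n h]|w [n _ h]]; exists n.
Qed.

Lemma S_homo w : (forall j, 0 < g j w) -> {homo (S ^~ w) : m n / (m <= n)%N >-> m <= n}.
Proof.
move=> g0; apply/nondecreasing_seqP => n.
by rewrite /S big_ord_recr/= lerDl ltW.
Qed.

Lemma exceeds_law x N : 0 < x -> (0 < N)%N ->
  `|fine (P (exceeds x)) - doob N 0 x| <=
    2 * (expR (- (x / 2)) ^+ N / (1 - expR (- (x / 2)))).
Proof.
(* The index [i <= n] makes these sets increase everywhere, whereas the partial sums increase only
   almost surely. *)
move=> x0 N0; pose F n := [set w | exists2 i, (i <= n)%N & x < S i w].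
have mF n : measurable (F n).
  rewrite (_ : F n = \bigcup_(i in `I_n.+1) [set w | x < S i w]).
    by apply: bigcup_measurable.
  by apply/seteqP; split => [w [i ni h]|w [i ni h]]; exists i.
have -> : exceeds x = \bigcup_n F n.
  apply/seteqP; split => [w [n h]|w [n _ [i _ h]]]; last by exists i.
  by exists n => //; exists n.
apply: probability_limit => //.
  by move=> m n mn; apply/subsetPset => w [i im h]; exists i => //; exact: leq_trans mn.
move=> e e0; have [n0 hn0] := hypo_tail_doob x0 N0 e0.
exists (maxn n0 1) => n; rewrite geq_max => /andP[n0n n1].
suff -> : P (F n) = P [set w | x < S n w].
  by rewrite (hypoexponential_law indg lawg)//; exact: hn0.
apply/eqP; rewrite eq_le; apply/andP; split; apply: ae_le_measure => //.
  apply: filterS ae_exponential_gt0 => w g0 [i ni h].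
  exact: lt_le_trans h (S_homo g0 ni).
by apply: aeW => w h; exists n.
Qed.

(** Boundedness is read off [exceeds_law] with [N = 1]: exceeding [x] has probability at most
    [2 * r + 2 * (r / (1 - r))], where [r = expR (- (x / 2))]. *)
Lemma ae_sum_bounded : {ae P, forall w, exists K, forall n, S n w <= K}.
Proof.
exists (\bigcap_(n : nat) exceeds (n%:R / 16)); split.
- by apply: bigcapT_measurable => n; exact: measurable_exceeds.
- apply/eqP; rewrite eq_le measure_ge0 andbT; apply/lee_addgt0Pr => e e0.
  (* [x = n / 16] gives [r = expR (- (n / 32))]; once [2 * r <= 1], the bound is at most [6 * r],
     whence the constants [6] and [2]. *)
  rewrite add0e; have [n0 hn0] := @expRN_small R 6 _ e0.
  have [n1 hn1] := @expRN_small R 2 1 ltr01.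
  pose n := maxn (maxn n0 n1) 1.
  apply: (@le_trans _ _ (P (exceeds (n%:R / 16)))).
    apply: le_measure; rewrite ?inE//; [|exact: measurable_exceeds|by move=> w; apply].
    by apply: bigcapT_measurable => m; exact: measurable_exceeds.
  rewrite -[leLHS]fineK ?fin_num_measure//; last exact: measurable_exceeds.
  rewrite lee_fin.
  have x0 : 0 < n%:R / 16 :> R by rewrite divr_gt0// ltr0n leq_max orbT.
  have := exceeds_law x0 (ltnSn 0).
  have h0 := hn0 n (leq_trans (leq_maxl n0 n1) (leq_maxl _ _)).
  have h1 := hn1 n (leq_trans (leq_maxr n0 n1) (leq_maxl _ _)).
  rewrite /doob big_ord1 !mulr0 ch0 expr0 expr1 expr1n !mulr1 !mul1r.
  rewrite (_ : n%:R / 16 / 2 = n%:R / 32); last by field.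
  have r0 := expR_gt0 (- (n%:R / 32 : R)).
  move: (expR _) h0 h1 r0 => r h0 h1 r0.
  have r2 : r / (1 - r) <= 2 * r.
    by rewrite ler_pdivrMr; nra.
  by rewrite ler_norml => /andP[_]; lra.
- move=> w /= h n _; apply: contrapT => hn; apply: h; exists (n%:R / 16) => m.
  by rewrite leNgt; apply/negP => hm; apply: hn; exists m.
Qed.

Lemma sum_limit_exists : exists h : {RV P >-> R},
  {ae P, forall w, series (fun j => g j w : R) @ \oo --> (h w : R)}.
Proof.
(* The supremum of all partial sums: measurable everywhere, and the limit wherever they increase and
   are bounded. *)
pose h w := fine (esups (fun n => (S n w)%:E) 0).
have mh : measurable_fun setT h.
  apply: measurableT_comp => //.
  by apply: measurable_fun_esups => n; apply/measurable_EFinP.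
exists (RV_of P mh); have [g0 bd] := (ae_exponential_gt0, ae_sum_bounded).
apply: filterS2 g0 bd => w g0 [K hK]; rewrite seriesS.
have ndS : nondecreasing_seq (fun n => (S n w)%:E).
  by move=> m n mn; rewrite lee_fin; exact: S_homo.
have cS := ereal_nondecreasing_cvgn ndS.
have supE : ereal_sup (range (fun n => (S n w)%:E)) = esups (fun n => (S n w)%:E) 0.
  by rewrite /esups /sdrop/=; congr ereal_sup; apply/seteqP; split => x [n _ <-]; exists n.
rewrite supE in cS.
have fS : esups (fun n => (S n w)%:E) 0 \is a fin_num.
  rewrite -supE fin_numE; apply/andP; split.
    rewrite gt_eqF// (lt_le_trans (ltNyr (S 0%N w)))//.
    by apply: ereal_sup_ubound; exists 0%N.
  rewrite lt_eqF// (le_lt_trans _ (ltry K))//.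
  by apply: ge_ereal_sup => _ [n _ <-]; rewrite lee_fin.
have := @fine_cvg _ _ _ _ (fun n => (S n w)%:E) (h w); apply.
by rewrite /h fineK.
Qed.

Lemma sum_limit_law (h : {RV P >-> R}) :
  {ae P, forall w, series (fun j => g j w : R) @ \oo --> (h w : R)} ->
  P [set w | 0 < h w] = 1%E /\
  forall x, 0 < x -> P [set w | x < h w] = P (exceeds x).
Proof.
move=> ch_; have mgt x : measurable [set w | x < h w].
  have := measurable_fun_ltr (measurable_cst x) (@measurable_funPT _ _ _ _ h).
  by move=> /(_ measurableT [set true] I); rewrite setTI.
have key : {ae P, forall w, 0 < h w /\ forall x, x < h w <-> exists n, x < S n w}.
  apply: filterS2 ae_exponential_gt0 ch_ => w g0; rewrite seriesS => cS.
  have Sle n : S n w <= h w.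
    apply: (cvgr_to_ge cS); near=> m; apply: S_homo => //; near: m.
    exact: nbhs_infty_ge.
  split; first by apply: lt_le_trans (Sle 1%N); rewrite /S big_ord1.
  move=> x; split=> [xh|[n xn]]; last exact: lt_le_trans (Sle n).
  have /cvgrPdist_lt/(_ (h w - x)) := cS; rewrite subr_gt0 => /(_ xh)[n _ /(_ n (leqnn n))] /=.
  rewrite ger0_norm ?subr_ge0// => hn; exists n; lra.
split=> [|x x0].
  apply/eqP; rewrite eq_le probability_le1//= -[leLHS](probability_setT P).
  by apply: ae_le_measure => //; apply: filterS key => w [].
apply/eqP; rewrite eq_le; apply/andP; split; apply: ae_le_measure => //.
- exact: measurable_exceeds.
- by apply: filterS key => w [_ /(_ x)[]].
- exact: measurable_exceeds.
- by apply: filterS key => w [_ /(_ x)[]].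
Unshelve. all: by end_near.
Qed.

End exponential_series.

Lemma probability_eq_ccdf (R : realType) (d d' : measure_display)
    (T : measurableType d) (T' : measurableType d')
    (P : probability T R) (P' : probability T' R)
    (X : {RV P >-> R}) (X' : {RV P' >-> R}) :
  (forall x, ccdf X x = ccdf X' x) ->
  forall A : set R, measurable A -> distribution P X A = distribution P' X' A.
Proof.
move=> XX' A mA; pose G := @RGenOInfty.G R.
apply: (@measure_unique _ R _ G (fun n => `]- n%:R, +oo[%classic)) => //.
- exact: RGenOInfty.measurableE.
- move=> _ _ [x ->] [y ->]; exists (Num.max x y).
  apply/seteqP; split => z /=; rewrite !in_itv/= !andbT gt_max.
    by move=> [-> ->].
  by move=> /andP[].
- by move=> n; exists (- n%:R).
- apply/seteqP; split => // z _; exists (Num.bound `|z|) => //=.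
  rewrite in_itv/= andbT; have := archi_boundP (normr_ge0 z).
  by have := ler_norm (- z); rewrite normrN; lra.
- by move=> _ [x ->]; exact: XX'.
- by move=> n; rewrite (le_lt_trans (probability_le1 _ _)) ?ltry.
Qed.

(** * The largest atom of a point measure *)

Section largest_point_of_measure.
Context (R : realType) (m : {measure set R -> \bar R}).
Hypothesis pm : point_measure_on m `]0, +oo[%classic.

Let mass (x : R) := m `[x, +oo[%classic.

Let mass_homo x y : x <= y -> (mass y <= mass x)%E.
Proof. by move=> xy; apply: le_measure; rewrite ?inE//; exact: subset_itvr. Qed.

Let point_le_mass x : (m [set x] <= mass x)%E.
Proof.
by apply: le_measure; rewrite ?inE// => y /= ->; rewrite in_itv/= lexx.
Qed.

Let point_gt0 x : (0 < m [set x])%E -> 0 < x.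
Proof.
case: pm => m0 _ _ mx; rewrite ltNge; apply/negP => x0; move: mx.
rewrite ltNge -m0 => /negP; apply.
apply: le_measure; rewrite ?inE//; first exact: measurableC.
by move=> y /= ->; rewrite in_itv/= andbT; apply/negP; rewrite -leNgt.
Qed.

(** The candidate is the supremum of the levels with positive [mass]. Integer values keep [mass] at
    least [1] left of it, finiteness gives continuity from above at it, and the open ray beyond it
    is null; so it is an atom. *)
Lemma largest_point_exists : (exists2 x, 0 < x & (0 < mass x)%E) ->
  (exists2 x, 0 < x & mass x = 0%E) ->
  exists x, largest_point m x /\ forall y, 0 < y -> (0 < mass y)%E = (y <= x).
Proof.
move=> [x1 x10 mx1] [x2 x20 mx2].
pose U := [set x : R | 0 < x /\ (0 < mass x)%E].
have Ub y : U y -> y <= x2.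
  move=> [y0 my]; rewrite leNgt; apply/negP => /ltW /mass_homo.
  by rewrite mx2 leNgt my.
have supU : has_sup U.
  by split; [exists x1|exists x2 => y; exact: Ub].
pose x := sup U.
have Ux y : U y -> y <= x by move=> Uy; apply: ub_le_sup => //; case: supU.
have x0 : 0 < x by apply: (lt_le_trans x10); exact: Ux.
have below y : y < x -> (0 < mass y)%E.
  move=> yx; have [z Uz yz] := sup_gt (proj1 supU) yx.
  by case: Uz => _ mz; apply: (lt_le_trans mz); apply: mass_homo; exact: ltW.
have above y : x < y -> mass y = 0%E.
  move=> xy; apply/eqP; rewrite eq_le measure_ge0 andbT leNgt; apply/negP => my.
  by have := Ux y (conj (lt_trans x0 xy) my); rewrite leNgt xy.
have ge1 y : y < x -> (1 <= mass y)%E.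
  move=> yx; have := below y yx; case: pm => _ /(_ _ (measurable_itv `[y, +oo[)) + _.
  rewrite -/(mass y) => -[->|[n ->]]; first by rewrite leey.
  by rewrite lte_fin lee_fin ltr0n ler1n.
have fin y : 0 < y -> (mass y < +oo)%E.
  move=> y0; case: pm => _ _ /(_ `[y, x2]%classic (@segment_compact _ _ _)) h.
  have : (m `[y, x2]%classic < +oo)%E.
    by apply: h => z /=; rewrite !in_itv/= andbT => /andP[yz _]; exact: lt_le_trans yz.
  move=> fy; apply: (@le_lt_trans _ _ (m (`[y, x2]%classic `|` `[x2, +oo[%classic))).
    apply: le_measure; rewrite ?inE//; first exact: measurableU.
    move=> z /=; rewrite !in_itv/= !andbT => yz.
    by have [zx|xz] := leP z x2; [left; rewrite yz|right; exact: ltW].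
  rewrite (le_lt_trans (measureU2 _ (measurable_itv _) (measurable_itv _)))//.
  by rewrite [X in (_ + X)%E](_ : _ = 0%E) ?adde0//; exact: mx2.
have mass_x : (1 <= mass x)%E.
  (* [n.+2] keeps the left ends positive, where the mass is finite. *)
  pose F n : set R := `[x - x / n.+2%:R, +oo[%classic.
  have xF n : 0 < x / n.+2%:R < x.
    by rewrite divr_gt0//= ltr_pdivrMr// ltr_pMr// ltr1n.
  have FE : \bigcap_n F n = `[x, +oo[%classic.
    apply/seteqP; split => z /=; last first.
      rewrite in_itv/= andbT => xz n _; rewrite /F /= in_itv/= andbT.
      have /andP[xn _] := xF n; apply: le_trans xz.
      by rewrite lerBlDr lerDl ltW.
    move=> h; rewrite in_itv/= andbT leNgt; apply/negP => zx.
    have xz0 : 0 < x - z by rewrite subr_gt0.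
    have := h (Num.bound (x / (x - z))) I; rewrite /F /= in_itv/= andbT.
    have := archi_boundP (divr_ge0 (ltW x0) (ltW xz0)); set n := Num.bound _ => hn.
    have : x / n.+2%:R < x - z.
      rewrite ltr_pdivrMr// mulrC -ltr_pdivrMr//; apply: (lt_trans hn).
      by rewrite ltr_nat.
    by move=> hx; rewrite lerBlDr -lerBlDl leNgt hx.
  have cF : m \o F @ \oo --> mass x.
    rewrite /mass -FE; apply: nonincreasing_cvg_mu => //.
    - by apply: fin; have /andP[_ xn] := xF 0%N; rewrite subr_gt0.
    - by move=> n; exact: measurable_itv.
    - by rewrite FE.
    - move=> i j ij; apply/subsetPset => z; rewrite /F /= !in_itv/= !andbT.
      move=> h; apply: le_trans h; rewrite lerD2l lerN2 ler_pM2l//.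
      by rewrite lef_pV2 ?posrE// ler_nat.
  apply: (cvge_ge _ cF); apply: nearW => n.
  by apply: ge1; have /andP[xn _] := xF n; rewrite ltrBlDr ltrDl.
have right0 : m `]x, +oo[%classic = 0%E.
  apply/negligibleP; first exact: measurable_itv.
  rewrite (_ : `]x, +oo[%classic = \bigcup_n `[x + n.+1%:R^-1, +oo[%classic).
    apply: negligible_bigcup => n; apply/negligibleP; first exact: measurable_itv.
    by apply: above; rewrite ltrDl invr_gt0.
  apply/seteqP; split => z /=; last first.
    move=> [n _ /=]; rewrite !in_itv/= !andbT; apply: lt_le_trans.
    by rewrite ltrDl invr_gt0.
  rewrite in_itv/= andbT => xz; have xz0 : 0 < z - x by rewrite subr_gt0.
  exists (Num.bound (z - x)^-1) => //=; rewrite in_itv/= andbT.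
  have zi : 0 <= (z - x)^-1 by rewrite invr_ge0 ltW.
  have := archi_boundP zi; set n := Num.bound _ => hn.
  rewrite -lerBrDl invf_ple ?posrE//; apply: (le_trans (ltW hn)).
  by rewrite ler_nat.
have point_x : (0 < m [set x])%E.
  apply: (@lt_le_trans _ _ (mass x)); first exact: lt_le_trans mass_x.
  have -> : mass x = m ([set x] `|` `]x, +oo[%classic).
    rewrite /mass; congr (m _); apply/seteqP; split => z /=.
      rewrite !in_itv/= !andbT le_eqVlt => /predU1P[<-|xz]; [by left|by right].
    by rewrite !in_itv/= !andbT => -[->|/ltW].
  rewrite (le_trans (measureU2 _ (measurable_set1 x) (measurable_itv _)))//.
  by rewrite [X in (_ + X)%E]right0 adde0.
exists x; split.
  split=> // y my; apply: Ux; split; first exact: point_gt0.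
  exact: lt_le_trans (point_le_mass y).
move=> y y0; apply/idP/idP => [my|]; first by apply: Ux.
rewrite le_eqVlt => /predU1P[->|]; last exact: below.
exact: lt_le_trans mass_x.
Qed.

Lemma largest_point_uniq x y : largest_point m x -> largest_point m y -> x = y.
Proof.
by move=> [mx hx] [my hy]; apply/eqP; rewrite eq_le hx// hy.
Qed.

End largest_point_of_measure.

(** * Identification of the two tails *)

Lemma crossing_exceeds (R : realType) (d d' : measure_display)
    (T : measurableType d) (T' : measurableType d')
    (P : probability T R) (P' : probability T' R)
    (B : R -> {RV P >-> R}) (g : nat -> {RV P' >-> R}) :
  standard_brownian_motion B ->
  mutually_independent P' (fun j w => g j w) ->
  (forall (j : nat) (A : set R), measurable A ->
    distribution P' (g j) A = exponential_prob (j.+1%:R ^+ 2 / 2) A) ->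
  forall x, 0 < x -> P (crossing B x) = P' (exceeds g x).
Proof.
move=> HB indg lawg x x0; set r := expR (- (x / 2)).
have r0 : 0 < r by exact: expR_gt0.
have r1 : r < 1 by rewrite expR_lt1 oppr_lt0 divr_gt0.
have mc := @measurable_crossing _ _ _ _ B x.
have me := @measurable_exceeds _ _ _ _ g x.
rewrite -[LHS]fineK ?fin_num_measure// -[RHS]fineK ?fin_num_measure//.
congr EFin; apply/eqP; rewrite -subr_eq0 -normr_le0.
(* The two distances to [doob N.+1 0 x] are at most [r ^+ N.+1] and [2 * (r ^+ N.+1 / (1 - r))]. *)
pose c : R := 1 + 2 / (1 - r).
have cr : c * r ^+ N.+1 @[N --> \oo] --> (0 : R).
  have rN : r ^+ N.+1 @[N --> \oo] --> (0 : R).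
    by rewrite cvg_shiftS; apply: cvg_expr; rewrite ger0_norm// ltW.
  by have := cvgM (cvg_cst c) rN; rewrite mulr0; exact.
apply: (cvgr_to_ge cr); apply: nearW => N.
have h1 := crossing_probability HB x0 (ltn0Sn N).
have h2 := exceeds_law indg lawg x0 (ltn0Sn N).
apply: (le_trans (ler_distD (doob N.+1 0 x) _ _)).
apply: (le_trans (lerD h1 _)); first by rewrite distrC; exact: h2.
have -> : expR (- (N.+1%:R * x / 2)) = r ^+ N.+1.
  by rewrite /r -expRM_natl mulrN mulrA.
rewrite -/r /c le_eqVlt; apply/orP; left; apply/eqP; ring.
Qed.

Lemma cvg_ccdf_right (R : realType) (d : measure_display) (T : measurableType d)
    (P : probability T R) (X : {RV P >-> R}) x :
  ccdf X (x + n.+1%:R^-1) @[n --> \oo] --> ccdf X x.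
Proof.
have cx : x + n.+1%:R^-1 @[n --> \oo] --> x.
  by have := cvgD (cvg_cst x) (@cvg_harmonic R); rewrite addr0; exact.
have cr : x + n.+1%:R^-1 @[n --> \oo] --> x^'+.
  move=> A xA; have H : \forall n \near \oo, x < x + n.+1%:R^-1 -> A (x + n.+1%:R^-1).
    exact: cx _ xA.
  have H' : \forall n \near \oo, A (x + n.+1%:R^-1); last exact: H'.
  by apply: filterS H => n; apply; rewrite ltrDl invr_gt0.
exact: cvg_comp cr (@ccdf_right_continuous _ _ _ _ X x).
Qed.

(** * The law of the largest point *)

Section largest_point_of_process.
Context (R : realType) (d : measure_display) (T : measurableType d).
Context (P : probability T R) (B : R -> {RV P >-> R}) (M : R.-ker T ~> R).
Hypothesis HB : standard_brownian_motion B.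
Hypothesis HM : process_M B 0 M.

Definition heavy x : set T := [set w | (0 < M w `[x, +oo[%classic)%E].

(** The second implication loses a little: a hit of level [y] at real times is seen on a dyadic grid
    only at levels below [y]. *)
Lemma ae_heavy : {ae P, forall w,
  [/\ point_measure_on (M w) `]0, +oo[%classic,
      forall x, 0 < x -> crossing B x w -> heavy x w &
      forall x y, 0 < x -> x < y -> heavy y w -> crossing B x w]}.
Proof.
case: HB => _ cB _ _.
apply: filterS3 HM cB (ae_recurrent HB) => w [pm nuE] cb rec.
have hitE x : 0 < x -> heavy x w <->
    exists t, 0 <= t /\ reflected (fun t => B t w) 0 0 t = line x t.
  by move=> x0; rewrite /heavy /= nuE//; exact: nu_gt0.
split=> // [x x0 /crossingP[m [n h]]|x y x0 xy].
  by apply/hitE => //; exact: dyadic_cross_hit h.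
have y0 := lt_trans x0 xy.
move=> /(hitE _ y0)[t [t0 ht]]; apply/crossingP.
exact: hit_dyadic_cross xy y0 t0 ht.
Qed.

Context (d' : measure_display) (T' : measurableType d').
Context (P' : probability T' R) (h : {RV P' >-> R}).
Hypothesis h_gt0 : P' [set w | 0 < h w] = 1%E.
Hypothesis crossing_h : forall x, 0 < x -> P (crossing B x) = P' [set w | x < h w].

Lemma ccdfE (U : measure_display) (V : measurableType U) (Q : probability V R)
  (X : {RV Q >-> R}) x : ccdf X x = Q [set w | x < X w].
Proof.
by rewrite /ccdf /distribution /pushforward; congr (Q _); apply/seteqP;
  split => w /=; rewrite in_itv/= andbT.
Qed.

Let crossing_ccdf x : 0 < x -> P (crossing B x) = ccdf h x.
Proof. by move=> x0; rewrite ccdfE crossing_h. Qed.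

(** Crossing probabilities at the levels [n.+1%:R^-1] tend to [ccdf h 0], which is [1] because [h]
    is almost surely positive. *)
Lemma ae_some_heavy : {ae P, forall w, exists2 x, 0 < x & heavy x w}.
Proof.
pose F n : set T := crossing B n.+1%:R^-1.
have mF n : measurable (F n) by exact: measurable_crossing.
have mU : measurable (\bigcup_n F n) by exact: bigcupT_measurable.
have lb n : (P (F n) <= P (\bigcup_n F n))%E.
  by apply: le_measure; rewrite ?inE//; exact: bigcup_sup.
have PU : P (\bigcup_n F n) = 1%E.
  apply/eqP; rewrite eq_le probability_le1//=.
  have c : ccdf h n.+1%:R^-1 @[n --> \oo] --> ccdf h 0.
    by have := @cvg_ccdf_right _ _ _ _ h 0; under eq_fun do rewrite add0r.
  apply: (@le_trans _ _ (ccdf h 0)); first by rewrite ccdfE h_gt0.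
  apply: (cvge_le _ c); apply: nearW => n.
  by rewrite -crossing_ccdf ?invr_gt0//; exact: lb.
have aeU : {ae P, forall w, (\bigcup_n F n) w}.
  exists (~` \bigcup_n F n); split => //; first exact: measurableC.
  by rewrite probability_setC// PU subee.
apply: filterS2 ae_heavy aeU => w [_ ch _] [n _ Fn].
by exists n.+1%:R^-1; [rewrite invr_gt0|apply: ch; rewrite ?invr_gt0].
Qed.

Lemma ae_some_light : {ae P, forall w, exists2 x, 0 < x & ~ heavy x w}.
Proof.
pose F n : set T := crossing B n.+1%:R.
have mF n : measurable (F n) by exact: measurable_crossing.
have mI : measurable (\bigcap_n F n) by exact: bigcapT_measurable.
have PI : P (\bigcap_n F n) = 0%E.
  apply/eqP; rewrite eq_le measure_ge0 andbT.
  have c : ccdf h n.+1%:R @[n --> \oo] --> 0%E.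
    have c1 : n.+1%:R @[n --> \oo] --> (+oo%R : set_system R).
      by rewrite (cvg_shiftS (fun n => n%:R : R)); exact: cvgr_idn.
    exact: cvg_comp c1 (cvg_ccdfy0 h).
  apply: (cvge_ge _ c); apply: nearW => n.
  rewrite -crossing_ccdf//; apply: le_measure; rewrite ?inE//; first exact: mF.
  by move=> w /(_ n I).
have aeI : {ae P, forall w, ~ (\bigcap_n F n) w}.
  by exists (\bigcap_n F n); split => // w /= /contrapT.
apply: filterS2 ae_heavy aeI => w [_ _ hc] nF.
(* Level [n.+2] is heavy, but [hc] yields a crossing only at a smaller level, here [n.+1]. *)
apply: contrapT => hn; apply: nF => n _; apply: (hc _ n.+2%:R) => //.
  by rewrite ltr_nat.
by apply: contrapT => nh; apply: hn; exists n.+2%:R.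
Qed.

Lemma ae_largest : {ae P, forall w, exists x,
  largest_point (M w) x /\ forall y, 0 < y -> heavy y w <-> y <= x}.
Proof.
apply: filterS3 ae_heavy ae_some_heavy ae_some_light => w [pm _ _] hv [y y0 /negP].
rewrite -leNgt => ly; have ly0 : M w `[y, +oo[%classic = 0%E.
  by apply/eqP; rewrite eq_le ly measure_ge0.
have [x [lx hx]] := largest_point_exists pm hv (ex_intro2 _ _ y y0 ly0).
by exists x; split => // z z0; rewrite /heavy /= hx.
Qed.

(** The positive dyadic numbers, enumerated by decoding pairs: a countable dense family makes the
    largest point a countable supremum, hence measurable. The successor in the numerator excludes
    [0]. *)
Definition grid (n : nat) : R :=
  let p := odflt (0%N, 0%N) (choice.unpickle n) in p.1.+1%:R / 2 ^+ p.2.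

Lemma grid_gt0 n : 0 < grid n.
Proof. by rewrite divr_gt0// exprn_gt0. Qed.

Lemma grid_dense x y : 0 <= x -> x < y -> exists n, x < grid n < y.
Proof.
move=> x0 xy; have [m0 hm] : exists m0, forall m, (m0 <= m)%N -> (2 ^+ m)^-1 < y - x.
  by apply: invX2_small; rewrite subr_gt0.
have p2 : 0 < 2 ^+ m0 :> R by rewrite exprn_gt0.
have := truncn_itv (mulr_ge0 x0 (ltW p2)); set k := Num.trunc _ => /andP[k1 k2].
exists (choice.pickle (k, m0)); rewrite /grid choice.pickleK/=.
rewrite ltr_pdivlMr// k2/= ltr_pdivrMr// -natr1.
have := hm m0 (leqnn m0); rewrite -(ltr_pM2r p2) mulVf ?gt_eqF//.
rewrite mulrBl; lra.
Qed.

Lemma largest_point_RV : exists mu0 : {RV P >-> R},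
  {ae P, forall w, largest_point (M w) (mu0 w)}.
Proof.
(* The default [0] cannot raise the supremum, since the largest point is nonnegative. *)
pose u n w : \bar R := if (0 < M w `[grid n, +oo[%classic)%E then (grid n)%:E else 0%E.
pose f w := fine (esups (u ^~ w) 0).
have mf : measurable_fun setT f.
  apply: measurableT_comp => //; apply: measurable_fun_esups => n.
  apply: measurable_fun_ifT => //.
  by apply: measurable_fun_lte => //; exact: measurable_kernel.
exists (RV_of P mf); apply: filterS2 ae_heavy ae_largest => w [pm _ _] [x [lx hx]].
suff : esups (u ^~ w) 0 = x%:E.
  by move=> E; rewrite (_ : (RV_of P mf : T -> R) w = x)//= /f E.
have x0 : 0 <= x.
  rewrite leNgt; apply/negP => x0; case: lx; rewrite ltNge => /negP + _; apply.
  case: pm => <- _ _; apply: le_measure; rewrite ?inE//; first exact: measurableC.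
  by move=> y /= ->; rewrite in_itv/= andbT; apply/negP; rewrite -leNgt ltW.
have supE : esups (u ^~ w) 0 = ereal_sup (range (u ^~ w)).
  by rewrite /esups /sdrop/=; congr ereal_sup; apply/seteqP; split => y [n _ <-]; exists n.
rewrite supE; apply/eqP; rewrite eq_le; apply/andP; split.
  apply: ge_ereal_sup => _ [n _ <-]; rewrite /u; case: ifPn => [hn|_]; rewrite lee_fin//.
  exact/(hx _ (grid_gt0 n)).
have sup0 : (0 <= ereal_sup (range (u ^~ w)))%E.
  apply: (@le_trans _ _ (u 0%N w)); last by apply: ereal_sup_ubound; exists 0%N.
  by rewrite /u; case: ifPn => _ //; rewrite lee_fin ltW// grid_gt0.
rewrite leNgt; apply/negP.
case: (ereal_sup _) (@ereal_sup_ubound _ (range (u ^~ w))) sup0 => [s| |]// ub.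
rewrite lee_fin lte_fin => s0 /(grid_dense s0)[n /andP[sn nx]].
have := ub (u n w) (ex_intro2 _ _ n I erefl).
rewrite /u ifT; first by rewrite lee_fin leNgt sn.
by apply/(hx _ (grid_gt0 n)); exact: ltW.
Qed.

(** The two tails interlace: each at [y] is at most the other at any [x] with [0 <= x < y].
    Right-continuity then gives equality at nonnegative [x]; at negative [x] both tails are [1]. *)
Lemma largest_point_ccdf (mu0 : {RV P >-> R}) :
  {ae P, forall w, largest_point (M w) (mu0 w)} ->
  forall x, ccdf mu0 x = ccdf h x.
Proof.
move=> lmu.
have key : {ae P, forall w, 0 < mu0 w /\ forall y, 0 < y -> heavy y w <-> y <= mu0 w}.
  apply: filterS3 ae_heavy ae_largest lmu => w [pm _ _] [x [lx hx]] lm.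
  have -> : mu0 w = x by exact: largest_point_uniq lm lx.
  split=> //; case: lx => mx _; rewrite ltNge; apply/negP => x0; move: mx.
  case: pm => m0 _ _; rewrite ltNge -m0 => /negP; apply.
  apply: le_measure; rewrite ?inE//; first exact: measurableC.
  by move=> y /= ->; rewrite in_itv/= andbT; apply/negP; rewrite -leNgt.
have mgt y : measurable [set w | y < mu0 w].
  have := measurable_fun_ltr (measurable_cst y) (@measurable_funPT _ _ _ _ mu0).
  by move=> /(_ measurableT [set true] I); rewrite setTI.
have lower x y : 0 <= x -> x < y -> (ccdf h y <= ccdf mu0 x)%E.
  move=> x0 xy; have y0 := le_lt_trans x0 xy.
  rewrite -crossing_ccdf// ccdfE; apply: ae_le_measure => //.
    exact: measurable_crossing.
  apply: filterS2 ae_heavy key => w [_ ch _] [_ hv] /(ch _ y0) /(hv _ y0).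
  exact: lt_le_trans.
have upper x y : 0 <= x -> x < y -> (ccdf mu0 y <= ccdf h x)%E.
  (* [x] may be [0], whereas [hc] asks for a positive level below [y]; the midpoint is one. *)
  move=> x0 xy; pose z := (x + y) / 2.
  have xz : x < z by rewrite /z; lra.
  have zy : z < y by rewrite /z; lra.
  have z0 := le_lt_trans x0 xz.
  apply: (@le_trans _ _ (ccdf h z)); last by apply: ccdf_nonincreasing; exact: ltW.
  rewrite -crossing_ccdf// ccdfE; apply: ae_le_measure => //.
    exact: measurable_crossing.
  apply: filterS2 ae_heavy key => w [_ _ hc] [_ hv] /= yw.
  by apply: (hc _ _ z0 zy); apply/hv; [exact: lt_trans zy|exact: ltW].
move=> x; have [x0|x0] := leP 0 x.
  apply/eqP; rewrite eq_le; apply/andP; split.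
    apply: (cvge_le _ (@cvg_ccdf_right _ _ _ _ mu0 x)); apply: nearW => n.
    by apply: upper => //; rewrite ltrDl invr_gt0.
  apply: (cvge_le _ (@cvg_ccdf_right _ _ _ _ h x)); apply: nearW => n.
  by apply: lower => //; rewrite ltrDl invr_gt0.
transitivity (1 : \bar R)%E.
  apply/eqP; rewrite eq_le probability_le1//= ccdfE -[leLHS](probability_setT P).
  apply: ae_le_measure => //.
  by apply: filterS key => w [+ _ _]; exact: lt_trans.
apply/esym/eqP; rewrite eq_le probability_le1//=.
rewrite -[leLHS]h_gt0 -ccdfE; apply: ccdf_nonincreasing; exact: ltW.
Qed.

End largest_point_of_process.

(* [g j] stands for the (j+1)-st exponential variable. *)
Theorem proposition1p3 (R : realType) (d d' : measure_display)
    (T : measurableType d) (T' : measurableType d')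
    (P : probability T R) (P' : probability T' R)
    (B : R -> {RV P >-> R}) (M : R.-ker T ~> R) (g : nat -> {RV P' >-> R}) :
  standard_brownian_motion B ->
  process_M B 0 M ->
  mutually_independent P' (fun j w => g j w) ->
  (forall (j : nat) (A : set R), measurable A ->
    distribution P' (g j) A = exponential_prob (j.+1%:R ^+ 2 / 2) A) ->
  [/\ exists mu0 : {RV P >-> R}, {ae P, forall w, largest_point (M w) (mu0 w)},
      exists hmu0 : {RV P' >-> R},
        {ae P', forall w, series (fun j => g j w : R) @ \oo --> (hmu0 w : R)} &
      forall (mu0 : {RV P >-> R}) (hmu0 : {RV P' >-> R}),
        {ae P, forall w, largest_point (M w) (mu0 w)} ->
        {ae P', forall w, series (fun j => g j w : R) @ \oo --> (hmu0 w : R)} ->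
        forall A : set R, measurable A ->
          distribution P mu0 A = distribution P' hmu0 A].
Proof.
move=> HB HM indg lawg.
have crossE (h : {RV P' >-> R}) :
    {ae P', forall w, series (fun j => g j w : R) @ \oo --> (h w : R)} ->
    P' [set w | 0 < h w] = 1%E /\
    forall x, 0 < x -> P (crossing B x) = P' [set w | x < h w].
  move=> hE; have [h0 hl] := sum_limit_law lawg hE.
  by split=> // x x0; rewrite (crossing_exceeds HB indg lawg x0) hl.
(* Even the existence of a largest point uses the series: that some levels are heavy and some are
   not is read off the law of its sum. *)
have [h hE] := sum_limit_exists indg lawg; have [h0 hB] := crossE h hE.
split; [exact: (largest_point_RV HB HM h0 hB)|by exists h|].
move=> mu0 hmu0 lmu /crossE[hmu0_gt0 hmu0B]; apply: probability_eq_ccdf.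
exact: (largest_point_ccdf HB HM hmu0_gt0 hmu0B lmu).
Qed.
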